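(* Let $\Omega$ be a complete separable metric space and $\hat{\mathbb{E}}$ a regular sublinear expectation on $\mathcal{H}=C_{b.Lip}(\Omega)$ (extended to $L^1(\Omega)$). Let $d\ge1$, $n>1$, and let $\{X_i\}_{i=1}^n$ be an independent sequence of random vectors in $L^2(\Omega;\mathbb{R}^d)$ under $\hat{\mathbb{E}}$. For $i\le n$ set $$\Theta_i=\{\theta\in\mathbb{R}^d:\langle\theta,p\rangle\le\hat{\mathbb{E}}[\langle p,X_i\rangle]\text{ for all }p\in\mathbb{R}^d\},$$ and let $$\Theta=\Big\{\frac1n\sum_{i=1}^n\theta_i:\theta_i\in\Theta_i\text{ for }i\le n\Big\},\qquad \bar\sigma_n^2=\sup_{i\le n}\ \inf_{\theta_i\in\Theta_i}\hat{\mathbb{E}}[|X_i-\theta_i|^2],$$ $$L^2(\Omega;\Theta)=\{\xi\in L^2(\Omega;\mathbb{R}^d):\xi(\omega)\in\Theta\text{ for }\omega\in\Omega\}.$$ Then $$\inf_{\xi\in L^2(\Omega;\Theta)}\hat{\mathbb{E}}\left[\left|\frac1n\sum_{i=1}^nX_i-\xi\right|^2\right]\le\frac{\bar\sigma_n^2}{n}.$$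
   Context: Setting. $\Omega$ is a complete separable metric space with Borel $\sigma$-field $\mathcal{B}(\Omega)$; $\mathcal{H}=C_{b.Lip}(\Omega)$ is the space of bounded Lipschitz real functions on $\Omega$. A functional $\hat{\mathbb{E}}:\mathcal{H}\to\mathbb{R}$ is a regular sublinear expectation if for $X,Y,X_n\in\mathcal{H}$: (i) $X\ge Y$ implies $\hat{\mathbb{E}}[X]\ge\hat{\mathbb{E}}[Y]$; (ii) $\hat{\mathbb{E}}[c]=c$ for $c\in\mathbb{R}$; (iii) $\hat{\mathbb{E}}[X+Y]\le\hat{\mathbb{E}}[X]+\hat{\mathbb{E}}[Y]$; (iv) $\hat{\mathbb{E}}[\lambda X]=\lambda\hat{\mathbb{E}}[X]$ for $\lambda\ge0$; (v) $X_n\downarrow0$ implies $\hat{\mathbb{E}}[X_n]\downarrow0$. It is a known fact (representation theorem) that there exists a convex and weakly compact set $\mathcal{P}$ of probability measures on $(\Omega,\mathcal{B}(\Omega))$ with $\hat{\mathbb{E}}[X]=\sup_{P\in\mathcal{P}}E_P[X]$ for $X\in\mathcal{H}$. For $p\ge1$, $L^p(\Omega)$ is the completion of $\mathcal{H}$ under the norm $\|X\|_p=(\hat{\mathbb{E}}[|X|^p])^{1/p}$; $L^p(\Omega)\subset L^1(\Omega)$, $\hat{\mathbb{E}}$ extends continuously to $L^1(\Omega)$, and the representation $\hat{\mathbb{E}}[X]=\sup_{P\in\mathcal{P}}E_P[X]$ still holds for $X\in L^1(\Omega)$. As usual, elements of $L^p(\Omega)$ are regarded as random variables on $\Omega$,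 identified when they agree outside a set that is null under every $P\in\mathcal{P}$; the condition $\xi(\omega)\in\Theta$ for $\omega\in\Omega$ refers to a representative of $\xi$. $L^p(\Omega;\mathbb{R}^d)$ is the set of random vectors $X=(X^1,\ldots,X^d)^T$ with every $X^j\in L^p(\Omega)$. Independence. $C_{b.Lip}(\mathbb{R}^m)$ is the space of bounded Lipschitz functions on $\mathbb{R}^m$. $Y\in L^1(\Omega;\mathbb{R}^{d_2})$ is independent of $X\in L^1(\Omega;\mathbb{R}^{d_1})$ if for each $\psi\in C_{b.Lip}(\mathbb{R}^{d_1+d_2})$, $\hat{\mathbb{E}}[\psi(X,Y)]=\hat{\mathbb{E}}\big[\hat{\mathbb{E}}[\psi(x,Y)]_{x=X}\big]$. A sequence $\{X_i\}_{i=1}^n\subset L^1(\Omega;\mathbb{R}^d)$, $n>1$, is independent if $X_{i+1}$ is independent of $(X_1,\ldots,X_i)$ for $1\le i\le n-1$ (this notion is not symmetric). $\langle\cdot,\cdot\rangle$ and $|\cdot|$ are the Euclidean inner product and norm. *)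

(* Defs.v *)
From HB Require Import structures.
From mathcomp Require Import all_boot all_order all_algebra.
From mathcomp Require Import all_classical all_reals all_analysis.

Set Implicit Arguments.
Unset Strict Implicit.
Unset Printing Implicit Defensive.

Import Order.TTheory GRing.Theory Num.Theory.
Import numFieldNormedType.Exports.

Local Open Scope classical_set_scope.
Local Open Scope ring_scope.

(* Pointed, hence nonempty: this costs no generality below, because no
   functional on an empty space satisfies [E c = c] for all constants. *)
#[short(type="completeMetricType")]
HB.structure Definition CompleteMetric (K : numDomainType) :=
  {T of Metric K T & Complete T}.

Definition separable_space (T : topologicalType) : Prop :=
  exists2 D : set T, countable D & dense D.

Notation Borel T := (g_sigma_algebraType (@open T)).

Section euclidean.
Context {R : realType} {m : nat}.
Implicit Types u v : 'rV[R]_m.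

Definition dotv u v : R := \sum_(j < m) u ord0 j * v ord0 j.

(* The library norm on matrices is the sup norm. *)
Definition enorm u : R := Num.sqrt (dotv u u).

Definition edist u v : R := enorm (u - v).

End euclidean.

Definition bLip {R : realType} {T : Type} (dist : T -> T -> R) (f : T -> R) :=
  (exists M, forall x, `|f x| <= M) /\
  (exists L, forall x y, `|f x - f y| <= L * dist x y).

Section sublinear_expectation.
Context {R : realType} {Omega : completeMetricType R}.

Definition HbLip (X : Omega -> R) : Prop := bLip (@mdist R Omega) X.

(* A functional on HbLip is a total function of which only the values on HbLip
   are ever used. *)
Record regular_sublinear (E : (Omega -> R) -> R) : Prop := {
  rs_monotone : forall X Y, HbLip X -> HbLip Y ->
    (forall w, Y w <= X w) -> E Y <= E X ;
  rs_const : forall c : R, E (fun _ => c) = c ;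
  rs_subadd : forall X Y, HbLip X -> HbLip Y ->
    E (fun w => X w + Y w) <= E X + E Y ;
  rs_poshom : forall (l : R) X, 0 <= l -> HbLip X ->
    E (fun w => l * X w) = l * E X ;
  rs_regular : forall X : nat -> Omega -> R, (forall k, HbLip (X k)) ->
    (forall w, nonincreasing_seq (fun k => X k w)) ->
    (forall w, X k w @[k --> \oo] --> (0 : R)) ->
    nonincreasing_seq (fun k => E (X k)) /\ E (X k) @[k --> \oo] --> (0 : R) }.

Definition convex_probs (P : set (probability (Borel Omega) R)) : Prop :=
  forall mu nu (t : R), P mu -> P nu -> 0 <= t <= 1 ->
    exists2 rho, P rho & forall A : set (Borel Omega), measurable A ->
      rho A = (t%:E * mu A + (1 - t)%:E * nu A)%E.

Definition bounded_continuous : Type :=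
  {f : Omega -> R | continuous f /\ exists M, forall w, `|f w| <= M}.

Definition pairing (mu : probability (Borel Omega) R) :
    {ptws bounded_continuous -> R} :=
  fun f => \int[mu]_w (sval f w).

(* The topology of weak convergence is the coarsest one for which
   mu |-> \int f dmu is continuous for every bounded continuous f. *)
Definition weakly_compact (P : set (probability (Borel Omega) R)) : Prop :=
  compact (P : set (initial_topology pairing)).

Definition upper_expectation (P : set (probability (Borel Omega) R))
    (X : Omega -> R) : \bar R :=
  ereal_sup [set (\int[mu]_w (X w)%:E)%E | mu in P].

Record represents (P : set (probability (Borel Omega) R))
    (E : (Omega -> R) -> R) : Prop := {
  rep_convex : convex_probs P ;
  rep_compact : weakly_compact P ;
  rep_sup : forall X, HbLip X -> (E X)%:E = upper_expectation P X }.

Section Lp_spaces.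
Variable P : set (probability (Borel Omega) R).

Definition upper_norm (p : R) (X : Omega -> R) : \bar R :=
  poweR (upper_expectation P (fun w => `|X w| `^ p)) p^-1.

Definition Lp_approx (p : R) (Xs : nat -> Omega -> R) (X : Omega -> R) : Prop :=
  (forall k, HbLip (Xs k)) /\
  upper_norm p (fun w => Xs k w - X w) @[k --> \oo] --> (0 : \bar R)%E.

(* The completion of HbLip for the norm [upper_norm p], realised by Borel
   random variables. Elements are representatives, not classes modulo equality
   outside a set null under every member of P. *)
Definition Lp (p : R) (X : Omega -> R) : Prop :=
  measurable_fun setT (X : Borel Omega -> R) /\ exists Xs, Lp_approx p Xs X.

Definition Lpv (p : R) (d : nat) (X : Omega -> 'rV[R]_d) : Prop :=
  forall j : 'I_d, Lp p (fun w => X w ord0 j).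

(* The continuous extension to L^1 of a functional on HbLip. *)
Definition extend (E : (Omega -> R) -> R) (X : Omega -> R) : R :=
  get [set c : R | exists2 Xs, Lp_approx 1 Xs X & E (Xs k) @[k --> \oo] --> c].

Definition L2_valued (d : nat) (Th : set 'rV[R]_d) : set (Omega -> 'rV[R]_d) :=
  [set xi | Lpv 2 xi /\ forall w, Th (xi w)].

End Lp_spaces.

Section independence.
(* In this section and the next one, E is meant to be defined on L^1. *)
Variable E : (Omega -> R) -> R.

Definition independent_of (d1 d2 : nat) (Y : Omega -> 'rV[R]_d2)
    (X : Omega -> 'rV[R]_d1) : Prop :=
  forall psi : 'rV[R]_(d1 + d2) -> R, bLip edist psi ->
    E (fun w => psi (row_mx (X w) (Y w))) =
    E (fun w => E (fun w' => psi (row_mx (X w) (Y w')))).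

(* (X_0, ..., X_{i-1}) as a single vector of size i * d *)
Definition initial_vars (d n : nat) (X : 'I_n -> Omega -> 'rV[R]_d)
    (i : 'I_n) (w : Omega) : 'rV[R]_(i * d) :=
  mxvec (\matrix_(k < i) X (widen_ord (ltnW (ltn_ord i)) k) w).

Definition independent_seq (d n : nat) (X : 'I_n -> Omega -> 'rV[R]_d) : Prop :=
  forall i : 'I_n, (0 < i)%N -> independent_of (X i) (initial_vars X i).

End independence.

Section mean_uncertainty.
Variables (E : (Omega -> R) -> R) (d n : nat) (X : 'I_n -> Omega -> 'rV[R]_d).

Definition Theta_i (i : 'I_n) : set 'rV[R]_d :=
  [set th | forall p : 'rV[R]_d, dotv th p <= E (fun w => dotv p (X i w))].

Definition Theta : set 'rV[R]_d :=
  [set n%:R^-1 *: \sum_(i < n) th i | th in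
    [set th : 'I_n -> 'rV[R]_d | forall i, Theta_i i (th i)]].

Definition sigma2 : \bar R :=
  ereal_sup [set ereal_inf [set (E (fun w => enorm (X i w - th) ^+ 2))%:E
                           | th in Theta_i i] | i in [set: 'I_n]].

End mean_uncertainty.

End sublinear_expectation.

(* Main.v *)
Require Import Defs.
From HB Require Import structures.
From mathcomp Require Import all_boot all_order all_algebra.
From mathcomp Require Import all_classical all_reals all_analysis.
From mathcomp Require Import measurable_realfun ring lra.

Set Implicit Arguments.
Unset Strict Implicit.
Unset Printing Implicit Defensive.

Import Order.TTheory GRing.Theory Num.Theory.
Import numFieldNormedType.Exports.

Local Open Scope classical_set_scope.
Local Open Scope ring_scope.

(** The pointwise best [xi] is the Euclidean projection of the mean of the [X i]
    on the compact convex set [Theta], and it is admissible.  With [K k] the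
    Minkowski sum of the first [k] sets [Theta_i] and [S k] the sum of the first
    [k] variables, the squared error of this [xi] is [n^-2 dist(S n, K n)^2], so it
    suffices to show, for any choice of [th i],
      [E (dist(S n, K n)^2) <= \sum_i E (|X i - th i|^2)].

    This is an induction on the number of terms.  Freeze a value [x] of the
    earlier sum, let [a] be any point of the earlier Minkowski sum, and let [M]
    be the mean of the next variable [V] under a member [mu] of [P].  Since [M]
    belongs to the [Theta_i] of [V], the point [a + M] competes for the new
    distance, and
      [int |x + V - (a + M)|^2 = |x - a|^2 + int |V - M|^2
                              <= |x - a|^2 + E (|V - th|^2)],
    the last step because the mean minimises the variance.  The final bound does
    not mention [mu], so it survives the infimum over [a] and the supremum over
    [P] ([Rintegral_setdist_le]).  Independence lets [x] be replaced by the
    earlier sum ([extend_setdist_independent_le]); it speaks of bounded Lipschitz test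
    functions, so it is applied to the distances truncated at [N], and the
    truncation is removed by [extend_truncation].

    What remains is to keep every variable inside the spaces on which [E] is the
    supremum of the expectations under [P] ([extendE]).  All of them are
    Lipschitz functions of vectors in L^2, or squares of such functions:
    [Lp_eps2_lipschitz] and [Lp_eps_sqr] cover these, and
    [nearest_nonexpansive] makes the projection one of them. *)

(* The Euclidean distance, hidden by the extended-real [edist]. *)
Local Notation edist := Defs.edist.

(** * Euclidean geometry *)

Section euclidean.
Context {R : realType} {m : nat}.
Implicit Types (u v w : 'rV[R]_m) (a : R).

Lemma dotvC u v : dotv u v = dotv v u.
Proof. by apply: eq_bigr => j _; rewrite mulrC. Qed.

Lemma dotvDl u v w : dotv (u + v) w = dotv u w + dotv v w.
Proof. by rewrite -big_split; apply: eq_bigr => j _; rewrite mxE mulrDl. Qed.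

Lemma dotvZl a u v : dotv (a *: u) v = a * dotv u v.
Proof. by rewrite mulr_sumr; apply: eq_bigr => j _; rewrite mxE mulrA. Qed.

Lemma dotvNl u v : dotv (- u) v = - dotv u v.
Proof. by rewrite -scaleN1r dotvZl mulN1r. Qed.

Lemma dotvDr u v w : dotv u (v + w) = dotv u v + dotv u w.
Proof. by rewrite dotvC dotvDl !(dotvC u). Qed.

Lemma dotvZr a u v : dotv u (a *: v) = a * dotv u v.
Proof. by rewrite dotvC dotvZl dotvC. Qed.

Lemma dotvNr u v : dotv u (- v) = - dotv u v.
Proof. by rewrite dotvC dotvNl dotvC. Qed.

Definition dotvE := (dotvDl, dotvDr, dotvNl, dotvNr, dotvZl, dotvZr).

Lemma dotv_ge0 u : 0 <= dotv u u.
Proof. by apply: sumr_ge0 => j _; rewrite -expr2 sqr_ge0. Qed.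

Lemma enorm_ge0 u : 0 <= enorm u.
Proof. exact: sqrtr_ge0. Qed.

Lemma enorm_sqr u : enorm u ^+ 2 = dotv u u.
Proof. by rewrite sqr_sqrtr // dotv_ge0. Qed.

Lemma enormD_sqr u v :
  enorm (u + v) ^+ 2 = enorm u ^+ 2 + 2 * dotv u v + enorm v ^+ 2.
Proof. by rewrite !enorm_sqr !dotvE (dotvC v u); ring. Qed.

Lemma enormN u : enorm (- u) = enorm u.
Proof. by rewrite /enorm dotvNl dotvNr opprK. Qed.

Lemma enormB u v : enorm (u - v) = enorm (v - u).
Proof. by rewrite -enormN opprB. Qed.

Lemma enormZ a u : enorm (a *: u) = `|a| * enorm u.
Proof.
by rewrite /enorm dotvZl dotvZr mulrA -expr2 sqrtrM ?sqr_ge0 // sqrtr_sqr.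
Qed.

Lemma coord_le_enorm u j : `|u ord0 j| <= enorm u.
Proof.
rewrite -sqrtr_sqr ler_wsqrtr // /dotv (bigD1 j) //= -expr2 lerDl.
by apply: sumr_ge0 => k _; rewrite -expr2 sqr_ge0.
Qed.

(** The inequality is [0 <= |c u - b v|^2] with [b = <u,v>], [c = <v,v>]. *)
Lemma dotv_sqr_le u v : dotv u v ^+ 2 <= dotv u u * dotv v v.
Proof.
have [v0|vn0] := eqVneq (dotv v v) 0.
  suff -> : dotv u v = 0 by rewrite expr0n /= mulr_ge0 ?dotv_ge0.
  apply: big1 => j _; suff -> : v ord0 j = 0 by rewrite mulr0.
  apply/eqP; rewrite -normr_le0 (le_trans (coord_le_enorm v j)) //.
  by rewrite /enorm v0 sqrtr0.
have vgt0 : 0 < dotv v v by rewrite lt_def vn0 dotv_ge0.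
have := dotv_ge0 (dotv v v *: u - dotv u v *: v).
rewrite !dotvE (dotvC v u) => h.
rewrite -(ler_pM2l vgt0) -subr_ge0.
by apply: le_trans h _; rewrite le_eqVlt; apply/orP; left; apply/eqP; ring.
Qed.

Lemma dotv_le_enorm u v : dotv u v <= enorm u * enorm v.
Proof.
rewrite (le_trans (ler_norm _)) // -sqrtrM ?dotv_ge0 // -sqrtr_sqr.
by rewrite ler_wsqrtr // dotv_sqr_le.
Qed.

Lemma enormD u v : enorm (u + v) <= enorm u + enorm v.
Proof.
rewrite -(@ler_pXn2r _ 2) ?nnegrE ?addr_ge0 ?enorm_ge0 //.
by rewrite enormD_sqr sqrrD; have := dotv_le_enorm u v; lra.
Qed.

Lemma enorm_dist u v : `|enorm u - enorm v| <= enorm (u - v).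
Proof.
have h (x y : 'rV[R]_m) : enorm x - enorm y <= enorm (x - y).
  by rewrite lerBlDr; have := enormD (x - y) y; rewrite subrK.
by rewrite ler_norml lerNl opprB h andbT enormB h.
Qed.

Lemma enorm_sum (n : nat) (F : 'I_n -> 'rV[R]_m) :
  enorm (\sum_i F i) <= \sum_i enorm (F i).
Proof.
elim/big_ind2 : _ => // [|x y z t xy zt].
  by rewrite /enorm /dotv big1 ?sqrtr0 // => j _; rewrite mxE mul0r.
by rewrite (le_trans (enormD _ _)) // lerD.
Qed.

Lemma enorm_le_sum u : enorm u <= \sum_j `|u ord0 j|.
Proof.
rewrite {1}[u]row_sum_delta (le_trans (enorm_sum _)) //.
apply: ler_sum => j _; rewrite enormZ ler_piMr // /enorm /dotv.
rewrite (bigD1 j) //= !mxE !eqxx mulr1 big1 ?addr0 ?sqrtr1 // => k kj.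
by rewrite !mxE (negbTE kj) mulr0.
Qed.

End euclidean.

(** * Distance to a set and projection *)

(** [bLip] for the Euclidean distance, without boundedness and with the
    constant exposed. *)
Definition elipschitz {R : realType} {m : nat} (L : R) (f : 'rV[R]_m -> R) :=
  forall u v, `|f u - f v| <= L * edist u v.

Section distance.
Context {R : realType} {m : nat}.
Implicit Types (u v : 'rV[R]_m) (A : set 'rV[R]_m).

Definition setdist A u : R := inf [set edist u a | a in A].

Lemma setdist_le A u a : A a -> setdist A u <= edist u a.
Proof.
move=> Aa; apply: inf_lbound; last by exists a.
by exists 0 => _ [b _ <-]; exact: enorm_ge0.
Qed.

Lemma le_setdist A u (b : R) : A !=set0 ->
  (forall a, A a -> b <= edist u a) -> b <= setdist A u.
Proof.
move=> [a0 Aa0] h; apply: lb_le_inf; first by exists (edist u a0), a0.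
by move=> _ [a Aa <-]; exact: h.
Qed.

Lemma setdist_ge0 A u : A !=set0 -> 0 <= setdist A u.
Proof. by move=> A0; apply: le_setdist => // a _; exact: enorm_ge0. Qed.

(** Bounds by squared distances pass to the infimum, squaring being monotone
    on nonnegative reals; [c] allows for an error term, of either sign. *)
Lemma le_setdist_sqr A u (b c : R) : A !=set0 ->
  (forall a, A a -> b <= edist u a ^+ 2 + c) -> b <= setdist A u ^+ 2 + c.
Proof.
move=> A0 h; rewrite -lerBlDr.
have [bc0|bc0] := leP (b - c) 0; first by rewrite (le_trans bc0) // sqr_ge0.
rewrite -(sqr_sqrtr (ltW bc0)) ler_pXn2r ?nnegrE ?sqrtr_ge0 ?setdist_ge0 //.
apply: le_setdist => // a Aa.
rewrite -(@ler_pXn2r _ 2) ?nnegrE ?sqrtr_ge0 ?enorm_ge0 //.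
by rewrite sqr_sqrtr ?(ltW bc0) // lerBlDr h.
Qed.

Lemma setdist_lipschitz A : A !=set0 -> elipschitz 1 (setdist A).
Proof.
move=> A0; have h u v : setdist A u - setdist A v <= edist u v.
  rewrite lerBlDr -lerBlDl; apply: le_setdist => // a Aa.
  rewrite lerBlDl (le_trans (setdist_le _ Aa)) // /edist.
  by rewrite (le_trans _ (enormD _ _)) // addrA subrK.
move=> u v; rewrite mul1r ler_norml h andbT lerNl opprB.
by rewrite /edist enormB h.
Qed.

(** A nearest point [p] of a convex set satisfies [<u - p, a - p> <= 0]:
    otherwise a short step from [p] towards [a] gets closer to [u]. *)
Lemma nearest_dotv_le0 A u p a :
  (forall x y (t : R), A x -> A y -> 0 <= t <= 1 ->
    A (x + t *: (y - x))) ->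
  A p -> A a -> (forall b, A b -> edist u p <= edist u b) ->
  dotv (u - p) (a - p) <= 0.
Proof.
move=> cvxA Ap Aa pmin; rewrite leNgt; apply/negP => c_gt0.
set c := dotv _ _ in c_gt0; pose q := dotv (a - p) (a - p).
have q0 : 0 <= q by exact: dotv_ge0.
(* the step [t] changes the squared distance by [t (t q - 2 c)]; this [t] is at
   most 1 and satisfies [t q <= c], which makes the change negative *)
pose t := c / (c + q); have cq0 : 0 < c + q by rewrite ltr_pwDl.
have t0 : 0 < t by rewrite divr_gt0.
have t1 : t <= 1 by rewrite ler_pdivrMr // mul1r lerDl.
have tq : t * q <= c.
  by rewrite /t mulrAC ler_pdivrMr // mulrDr -subr_ge0 addrK sqr_ge0.
have := pmin _ (cvxA _ _ t Ap Aa _); rewrite (ltW t0) t1 => /(_ isT).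
rewrite -(@ler_pXn2r _ 2) ?nnegrE ?enorm_ge0 // /edist opprD addrA.
rewrite (enormD_sqr (u - p)) dotvNr dotvZr -/c enormN (enorm_sqr (t *: _)).
rewrite dotvZl dotvZr -/q => h.
have {h} : 0 <= t * (t * q - 2 * c) by lra.
by rewrite pmulr_rge0 //; lra.
Qed.

Definition nearest A u : 'rV[R]_m :=
  get [set p | A p /\ forall b, A b -> edist u p <= edist u b].

Lemma nearestP A u :
  (exists2 p, A p & forall b, A b -> edist u p <= edist u b) ->
  A (nearest A u) /\ forall b, A b -> edist u (nearest A u) <= edist u b.
Proof.
move=> [p Ap pmin].
have : exists p, [set p | A p /\ forall b, A b -> edist u p <= edist u b] p.
  by exists p.
by move/getPex.
Qed.

(** Adding the variational inequalities of the two projections gives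
    [|p - q|^2 <= <u - v, p - q>]. *)
Lemma nearest_nonexpansive A :
  (forall x y (t : R), A x -> A y -> 0 <= t <= 1 ->
    A (x + t *: (y - x))) ->
  (forall u, exists2 p, A p & forall b, A b -> edist u p <= edist u b) ->
  forall u v, enorm (nearest A u - nearest A v) <= edist u v.
Proof.
move=> cvxA exA u v.
have nP x := nearestP (exA x).
have [Ap pmin] := nP u; have [Aq qmin] := nP v.
set p := nearest A u in Ap pmin *; set q := nearest A v in Aq qmin *.
have h1 := nearest_dotv_le0 cvxA Ap Aq pmin.
have h2 := nearest_dotv_le0 cvxA Aq Ap qmin.
have h : enorm (p - q) ^+ 2 <= edist u v * enorm (p - q).
  apply: le_trans (dotv_le_enorm _ _); rewrite enorm_sqr.
  move: h1 h2; by rewrite !dotvE (dotvC q p); lra.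
have [->|pq0] := eqVneq (enorm (p - q)) 0; first exact: enorm_ge0.
have pq : 0 < enorm (p - q) by rewrite lt_def pq0 enorm_ge0.
by rewrite -(ler_pM2r pq) -expr2.
Qed.

End distance.
(** * Lipschitz functions of random vectors *)

(** Rational points make the McShane formula
    [f u = sup_q (f q - L \sum_j |u_j - q_j|)] a countable supremum, so that no
    sigma-algebra on row vectors is needed. *)
Lemma measurable_lipschitz_comp d (T : measurableType d) (R : realType)
    (m : nat) (L : R) (f : 'rV[R]_m -> R) (X : T -> 'rV[R]_m) :
  0 <= L -> elipschitz L f ->
  (forall j, measurable_fun setT (fun w => X w ord0 j)) ->
  measurable_fun setT (f \o X).
Proof.
move=> L0 fL mX; apply: (measurability _ (RGenOInfty.measurableE R)).
move=> _ [_ [a ->] <-]; rewrite setTI preimage_itvoy.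
pose F (q : 'rV[rat]_m) w := f (map_mx ratr q) -
  L * \sum_(j < m) `|X w ord0 j - ratr (q ord0 j)|.
rewrite [X in measurable X](_ : _ =
    \bigcup_(q : 'rV[rat]_m) [set w | a < F q w]); last first.
  apply/seteqP; split => w /=; last first.
    move=> [q _ /=]; rewrite /F => /lt_le_trans; apply.
    rewrite lerBlDr -lerBlDl (le_trans (ler_norm _)) // (le_trans (fL _ _)) //.
    rewrite ler_wpM2l // (le_trans (enorm_le_sum _)) //.
    by apply: ler_sum => j _; rewrite !mxE distrC.
  (* a rational point at sup-distance less than [e] costs at most
     [2 L m e < f (X w) - a] *)
  move=> afX; pose e := (f (X w) - a) / (2 * L * m%:R + 1).
  have den0 : 0 < 2 * L * m%:R + 1 by rewrite ltr_wpDl // !mulr_ge0.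
  have e0 : 0 < e by rewrite divr_gt0 // subr_gt0.
  have /choice[q hq] : forall j : 'I_m, exists q : rat,
      `|X w ord0 j - ratr q| < e.
    move=> j; have : X w ord0 j - e < X w ord0 j + e by lra.
    move=> /rat_in_itvoo[q]; rewrite in_itv /= => /andP[h1 h2].
    by exists q; rewrite ltr_norml; apply/andP; split; lra.
  exists (\row_j q j) => //=; rewrite /F.
  set s := \sum_(j < m) _.
  have hs : s <= m%:R * e.
    rewrite mulr_natl -[m in leRHS]card_ord -sumr_const.
    by apply: ler_sum => j _; rewrite !mxE ltW.
  have hf : f (X w) - f (map_mx ratr (\row_j q j)) <= L * s.
    rewrite (le_trans (ler_norm _)) // (le_trans (fL _ _)) //.
    rewrite ler_wpM2l // (le_trans (enorm_le_sum _)) //.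
    by apply: ler_sum => j _; rewrite !mxE.
  have : L * s <= L * (m%:R * e) by rewrite ler_wpM2l.
  have : 2 * (L * (m%:R * e)) + e = f (X w) - a.
    rewrite (_ : _ + e = (2 * L * m%:R + 1) * e); last by ring.
    by rewrite /e mulrC divfK // gt_eqF.
  lra.
apply: countable_bigcupT_measurable => [|q]; first exact: countableP.
have mF : measurable_fun setT (F q).
  apply: measurable_funB; first exact: measurable_cst.
  apply: measurable_funM; first exact: measurable_cst.
  apply: measurable_sum => j; apply: measurableT_comp => //.
  by apply: measurable_funB => //; exact: measurable_cst.
have := mF measurableT _ (measurable_itv `]a, +oo[).
by rewrite setTI preimage_itvoy.
Qed.

Section bounded_lipschitz.
Context {R : realType} {Omega : completeMetricType R}.
Implicit Types H : Omega -> R.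

Lemma HbLipP H : HbLip H -> exists M L : R, [/\ 0 <= M, 0 <= L,
  forall w, `|H w| <= M & forall x y, `|H x - H y| <= L * mdist x y].
Proof.
move=> [[M hM] [L hL]]; exists (Num.max 0 M), (Num.max 0 L).
split; rewrite ?le_max ?lexx //; first by move=> w; rewrite le_max hM orbT.
move=> x y; rewrite (le_trans (hL x y)) // ler_wpM2r ?mdist_ge0 //.
by rewrite le_max lexx orbT.
Qed.

Lemma HbLip_cst (c : R) : HbLip (fun _ : Omega => c).
Proof.
split; first by exists `|c|.
by exists 0 => x y; rewrite subrr normr0 mul0r.
Qed.

Lemma HbLip_measurable H :
  HbLip H -> measurable_fun setT (H : Borel Omega -> R).
Proof.
move=> /HbLipP[_ [L [_ L0 _ hL]]].
have cH : continuous H.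
  move=> x; apply/cvgrPdist_lt => e e0; apply/nbhs_ballP => /=.
  exists (e / (L + 1)); first by rewrite /= divr_gt0 // ltr_wpDl.
  move=> y; rewrite ballEmdist /= ltr_pdivlMr ?ltr_wpDl // => h.
  rewrite (le_lt_trans (hL x y)) // (le_lt_trans _ h) // mulrC.
  by rewrite ler_wpM2l ?mdist_ge0 // lerDl.
apply: (measurability _ (RGenOInfty.measurableE R)).
move=> _ [_ [a ->] <-]; rewrite setTI; apply: sub_sigma_algebra.
by apply: open_comp => // x _; exact: cH.
Qed.

Lemma HbLip_sqr H : HbLip H -> HbLip (fun w => H w ^+ 2).
Proof.
move=> /HbLipP[M [L [M0 L0 hM hL]]]; split.
  by exists (M ^+ 2) => w; rewrite normrX lerXn2r ?nnegrE.
exists (L * (2 * M)) => x y; rewrite subr_sqr normrM mulrAC.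
rewrite ler_pM // (le_trans (ler_normD _ _)) //.
by have := hM x; have := hM y; lra.
Qed.

Lemma HbLip_comp (m : nat) (L : R) (f : 'rV[R]_m -> R)
    (H : 'I_m -> Omega -> R) :
  0 <= L -> elipschitz L f -> (forall j, HbLip (H j)) ->
  HbLip (fun w => f (\row_j H j w)).
Proof.
move=> L0 fL /= hH.
have /choice[M hM] : forall j, exists M, forall w, `|H j w| <= M.
  by move=> j; case: (hH j).
have /choice[K hK] : forall j, exists K, forall x y,
    `|H j x - H j y| <= K * mdist x y.
  by move=> j; case: (hH j).
split.
  exists (`|f 0| + L * \sum_j M j) => w.
  rewrite -[f _](subrK (f 0)) addrC (le_trans (ler_normD _ _)) // lerD2l.
  rewrite (le_trans (fL _ _)) // ler_wpM2l // (le_trans (enorm_le_sum _)) //.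
  by apply: ler_sum => j _; rewrite !mxE subr0.
exists (L * \sum_j K j) => x y.
rewrite (le_trans (fL _ _)) // -mulrA ler_wpM2l //.
rewrite (le_trans (enorm_le_sum _)) // mulr_suml.
by apply: ler_sum => j _; rewrite !mxE.
Qed.

End bounded_lipschitz.
(** * The spaces L^1 and L^2 of a family of probabilities *)

Section nonneg_integrals.
Context d (T : measurableType d) (R : realType).
Variable mu : {measure set T -> \bar R}.
Implicit Types f g h : T -> R.

Lemma integral_lin_le f g h (a b G K : R) :
  measurable_fun setT f -> measurable_fun setT g -> measurable_fun setT h ->
  0 <= a -> 0 <= b ->
  (forall w, 0 <= f w) -> (forall w, 0 <= g w) -> (forall w, 0 <= h w) ->
  (forall w, f w <= a * g w + b * h w) ->
  (\int[mu]_w (g w)%:E <= G%:E -> \int[mu]_w (h w)%:E <= K%:E ->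
   \int[mu]_w (f w)%:E <= (a * G + b * K)%:E)%E.
Proof.
move=> mf mg mh a0 b0 f0 g0 h0 fgh gG hK.
have mE (k : T -> R) : measurable_fun setT k ->
    measurable_fun setT (fun w => (k w)%:E).
  by move=> mk; exact/measurable_EFinP.
apply: (@le_trans _ _ (\int[mu]_w (a%:E * (g w)%:E + b%:E * (h w)%:E)))%E.
  apply: ge0_le_integral => //=.
  - by move=> w _; rewrite lee_fin.
  - exact: mE.
  - by apply: emeasurable_funD; apply: measurable_funeM; exact: mE.
  - by move=> w _; rewrite lee_fin.
rewrite ge0_integralD //=; last 4 first.
- by move=> w _; rewrite lee_fin mulr_ge0.
- by apply: measurable_funeM; exact: mE.
- by move=> w _; rewrite lee_fin mulr_ge0.
- by apply: measurable_funeM; exact: mE.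
rewrite !ge0_integralZl_EFin //=; last 4 first.
- by move=> w _; rewrite lee_fin.
- exact: mE.
- by move=> w _; rewrite lee_fin.
- exact: mE.
by rewrite EFinD !EFinM leeD // lee_wpmul2l // lee_fin.
Qed.

Lemma integral_sum_le (m : nat) f (g : 'I_m -> T -> R) (G : R) :
  measurable_fun setT f -> (forall j, measurable_fun setT (g j)) ->
  (forall w, 0 <= f w) -> (forall j w, 0 <= g j w) ->
  (forall w, f w <= \sum_j g j w) ->
  (forall j, \int[mu]_w (g j w)%:E <= G%:E)%E ->
  (\int[mu]_w (f w)%:E <= (m%:R * G)%:E)%E.
Proof.
move=> mf mg f0 g0 fg gG.
apply: (@le_trans _ _ (\int[mu]_w \sum_(j < m) (g j w)%:E)%E).
  apply: ge0_le_integral => //=.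
  - by move=> w _; rewrite lee_fin.
  - exact/measurable_EFinP.
  - by apply: emeasurable_sum => j; exact/measurable_EFinP.
  - by move=> w _; rewrite sumEFin lee_fin.
rewrite ge0_integral_sum //=; last 2 first.
- by move=> j; exact/measurable_EFinP.
- by move=> j w _; rewrite lee_fin.
apply: (@le_trans _ _ (\sum_(j < m) G%:E)%E); first exact: lee_sum.
by rewrite sumEFin lee_fin sumr_const card_ord mulr_natl.
Qed.

End nonneg_integrals.

Lemma integral_probability_cst d (T : measurableType d) (R : realType)
    (mu : probability T R) (c : R) : (\int[mu]_w c%:E = c%:E)%E.
Proof.
rewrite integral_cst // [X in (_ * X)%E](_ : _ = 1%E) ?mule1 //.
exact: (probability_setT mu).
Qed.

Lemma Rintegral_probability_cst d (T : measurableType d) (R : realType)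
    (mu : probability T R) (c : R) : \int[mu]_w c = c.
Proof. by rewrite /Rintegral integral_probability_cst. Qed.

Section Lp_theory.
Context {R : realType} {Omega : completeMetricType R}.
Variable P : set (probability (Borel Omega) R).
Hypothesis P0 : P !=set0.
Implicit Types X Y H : Omega -> R.

Lemma le_upper_expectation mu X : P mu ->
  (\int[mu]_w (X w)%:E <= upper_expectation P X)%E.
Proof. by move=> Pmu; apply: ereal_sup_ubound; exists mu. Qed.

Lemma upper_expectation_le X (b : \bar R) :
  (forall mu, P mu -> \int[mu]_w (X w)%:E <= b)%E ->
  (upper_expectation P X <= b)%E.
Proof. by move=> h; apply: ge_ereal_sup => _ [mu Pmu <-]; exact: h. Qed.

Lemma upper_expectation_ge0 X : (forall w, 0 <= X w) ->
  (0 <= upper_expectation P X)%E.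
Proof.
case: P0 => mu Pmu X0; apply: le_trans (le_upper_expectation X Pmu).
by apply: integral_ge0 => w _; rewrite lee_fin.
Qed.

(** Membership in [Lp] without sequences and without p-th roots; the bound is
    uniform over [P], which is what the supremum in [upper_norm] says. *)
Definition Lp_eps (q : nat) X :=
  measurable_fun setT (X : Borel Omega -> R) /\
  forall e : R, 0 < e -> exists2 H, HbLip H &
    forall mu, P mu -> (\int[mu]_w (`|H w - X w| ^+ q)%:E <= e%:E)%E.

Lemma upper_normE (q : nat) X :
  upper_norm P q%:R X =
  poweR (upper_expectation P (fun w => `|X w| ^+ q)) q%:R^-1.
Proof.
rewrite /upper_norm; congr (poweR (upper_expectation P _) _).
by apply/funext => w; rewrite powR_mulrn.
Qed.

Lemma powR_natVK (q : nat) (e : R) : (0 < q)%N -> 0 <= e ->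
  (e ^+ q) `^ q%:R^-1 = e.
Proof.
move=> q0 e0; rewrite -powR_mulrn // -powRrM divff ?powRr1 //.
by rewrite pnatr_eq0 -lt0n.
Qed.

Lemma upper_norm_le (q : nat) X (e : R) : (0 < q)%N -> 0 <= e ->
  (forall mu, P mu -> (\int[mu]_w (`|X w| ^+ q)%:E <= (e ^+ q)%:E)%E) ->
  (upper_norm P q%:R X <= e%:E)%E.
Proof.
move=> q0 e0 h; rewrite upper_normE -[X in (_ <= X%:E)%E](powR_natVK q0) //.
have Uge0 := @upper_expectation_ge0 (fun w => `|X w| ^+ q).
rewrite -poweR_EFin; apply: gt0_ler_poweR; rewrite ?invr_ge0 //.
- by rewrite in_itv /= leey andbT Uge0 // => w; rewrite exprn_ge0.
- by rewrite in_itv /= leey andbT lee_fin exprn_ge0.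
- exact: upper_expectation_le.
Qed.

Lemma upper_norm_lt (q : nat) X (e : R) : (0 < q)%N -> 0 <= e ->
  (upper_norm P q%:R X < e%:E)%E ->
  forall mu, P mu -> (\int[mu]_w (`|X w| ^+ q)%:E <= (e ^+ q)%:E)%E.
Proof.
move=> q0 e0; rewrite upper_normE => h mu Pmu.
apply: le_trans (le_upper_expectation _ Pmu) _.
rewrite leNgt; apply/negP => /ltW eU; move: h; apply/negP; rewrite -leNgt.
rewrite -[X in (X%:E <= _)%E](powR_natVK q0) // -poweR_EFin.
apply: gt0_ler_poweR; rewrite ?invr_ge0 //.
- by rewrite in_itv /= leey andbT lee_fin exprn_ge0.
- by rewrite in_itv /= leey andbT (le_trans _ eU) // lee_fin exprn_ge0.
Qed.

Lemma cvg0_lt_near (u : nat -> \bar R) (e : R) :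
  u k @[k --> \oo] --> (0 : \bar R)%E -> 0 < e ->
  \forall k \near \oo, (u k < e%:E)%E.
Proof.
move=> /fine_cvgP[ufin /cvgrPdist_lt uc] e0; near=> k.
have ukfin : u k \is a fin_num by near: k.
rewrite -(fineK ukfin) lte_fin (le_lt_trans (ler_norm _)) //.
have : `|0 - fine (u k)| < e by near: k; exact: uc.
by rewrite sub0r normrN.
Unshelve. all: by end_near. Qed.

Lemma Lp_epsP (q : nat) X : (0 < q)%N -> Lp P q%:R X <-> Lp_eps q X.
Proof.
move=> q0; split=> -[mX hX]; split => //.
  move=> e e0; case: hX => Xs [hXs Xs0].
  have e1 : 0 < e `^ q%:R^-1 by rewrite powR_gt0.
  have [N _ hN] := cvg0_lt_near Xs0 e1.
  exists (Xs N) => // mu Pmu.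
  have := upper_norm_lt q0 (ltW e1) (hN N (leqnn N)) Pmu.
  have qn0 : q%:R != 0 :> R by rewrite pnatr_eq0 -lt0n.
  have eK : (e `^ q%:R^-1) ^+ q = e.
    by rewrite -powR_mulrn ?powR_ge0 // -powRrM mulVf // powRr1 // ltW.
  by rewrite eK.
have /choice[Xs hXs] : forall k : nat, exists H, HbLip H /\
    forall mu, P mu ->
      (\int[mu]_w (`|H w - X w| ^+ q)%:E <= (harmonic k ^+ q)%:E)%E.
  move=> k; have [|H hH h] := hX (harmonic k ^+ q); last by exists H.
  by rewrite exprn_gt0 // harmonic_gt0.
exists Xs; split=> [k|]; first by case: (hXs k).
apply: (squeeze_cvge _ (cvg_cst _) cvge_harmonic).
near=> k; apply/andP; split; first exact: poweR_ge0.
by apply: upper_norm_le => //; [exact: harmonic_ge0|case: (hXs k)].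
Unshelve. all: by end_near. Qed.

Lemma measurable_abs_subX (q : nat) X Y :
  measurable_fun setT (X : Borel Omega -> R) ->
  measurable_fun setT (Y : Borel Omega -> R) ->
  measurable_fun setT ((fun w => `|X w - Y w| ^+ q) : Borel Omega -> R).
Proof.
move=> mX mY; apply: measurable_funX; apply: measurableT_comp => //.
exact: measurable_funB.
Qed.

(** Compare [X] with a single bounded approximation. *)
Lemma Lp_eps2_bounded X : Lp_eps 2 X ->
  exists2 C : R, 0 <= C &
    forall mu, P mu -> (\int[mu]_w (X w ^+ 2)%:E <= C%:E)%E.
Proof.
move=> [mX /(_ 1 ltr01)[H hH h]]; have [M [_ [M0 _ hM _]]] := HbLipP hH.
exists (2 * M ^+ 2 + 2 * 1) => [|mu Pmu].
  by rewrite addr_ge0 // mulr_ge0 // sqr_ge0.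
have mH := HbLip_measurable hH.
apply: (@integral_lin_le _ _ _ mu _ (cst (M ^+ 2))
  (fun w => `|H w - X w| ^+ 2)) => //=.
- exact: measurable_funX.
- exact: measurable_abs_subX.
- by move=> w; exact: sqr_ge0.
- by move=> w; exact: sqr_ge0.
- move=> w; have := hM w.
  rewrite ler_norml real_normK ?num_real // => /andP[h1 h2].
  have : H w ^+ 2 <= M ^+ 2 by rewrite -subr_ge0 subr_sqr mulr_ge0 //; lra.
  have := sqr_ge0 (2 * H w - X w).
  nra.
- by rewrite integral_probability_cst.
- exact: h.
Qed.

Lemma Lp_eps_sqr X : Lp_eps 2 X -> Lp_eps 1 (fun w => X w ^+ 2).
Proof.
move=> X2; have [C C0 hC] := Lp_eps2_bounded X2.
case: X2 => mX hX; split; first exact: measurable_funX.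
move=> e e0.
(* |h^2 - x^2| <= (1 + 1/r) |h - x|^2 + r x^2, with [r C <= e/2] *)
pose r := e / (2 * (C + 1)).
have r0 : 0 < r by rewrite divr_gt0 // mulr_gt0 // ltr_wpDl.
have rC : r * C <= e / 2.
  have C1 : 0 < C + 1 by rewrite ltr_wpDl.
  have -> : r * C = e / 2 * (C / (C + 1)) by rewrite /r; field; rewrite gt_eqF.
  rewrite ler_piMr ?ler_pdivrMr ?mul1r ?lerDl //.
  by rewrite divr_ge0 // ltW.
have k0 : 0 < 1 + r^-1 by rewrite ltr_wpDl // invr_gt0.
pose e' := e / 2 / (1 + r^-1).
have [|H hH h] := hX e'; first by rewrite !divr_gt0.
exists (fun w => H w ^+ 2) => [|mu Pmu]; first exact: HbLip_sqr.
have mH := HbLip_measurable hH.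
have : (1 + r^-1) * e' + r * C <= e by rewrite mulrC divfK ?gt_eqF //; lra.
rewrite -lee_fin; apply: le_trans.
apply: (@integral_lin_le _ _ _ mu _ (fun w => `|H w - X w| ^+ 2)
  (fun w => X w ^+ 2)).
- by apply: measurable_abs_subX; exact: measurable_funX.
- exact: measurable_abs_subX.
- exact: measurable_funX.
- exact: ltW.
- exact: ltW.
- by move=> w; rewrite exprn_ge0.
- by move=> w; rewrite exprn_ge0.
- by move=> w; exact: sqr_ge0.
- move=> w; rewrite expr1 real_normK ?num_real //.
  move: (H w) (X w) => a b.
  have key : 2 * `|(a - b) * b| <= r^-1 * (a - b) ^+ 2 + r * b ^+ 2.
    have := sqr_ge0 (`|a - b| - r * `|b|); rewrite normrM.
    rewrite -(@pmulr_rge0 _ r^-1) ?invr_gt0 // => hs.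
    rewrite -subr_ge0; apply: le_trans hs _.
    rewrite -[(a - b) ^+ 2](real_normK (num_real _)).
    rewrite -[b ^+ 2](real_normK (num_real _)).
    rewrite le_eqVlt; apply/orP; left; apply/eqP.
    by field; rewrite gt_eqF.
  have -> : a ^+ 2 - b ^+ 2 = (a - b) ^+ 2 + 2 * ((a - b) * b) by ring.
  rewrite (le_trans (ler_normD _ _)) // ger0_norm ?sqr_ge0 //.
  by rewrite normrM (ger0_norm (_ : 0 <= 2)) //; lra.
- exact: h.
- exact: hC.
Qed.

Lemma Lp_eps2_1 X : Lp_eps 2 X -> Lp_eps 1 X.
Proof.
move=> [mX hX]; split => // e e0.
(* |y| <= |y|^2 / (2 e) + e / 2, applied to the error y of an approximation *)
have [|H hH h] := hX (e ^+ 2); first by rewrite exprn_gt0.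
exists H => // mu Pmu; have mH := HbLip_measurable hH.
have : (2 * e)^-1 * e ^+ 2 + 1 * (e / 2) <= e.
  by rewrite le_eqVlt; apply/orP; left; apply/eqP; field; rewrite gt_eqF.
rewrite -lee_fin; apply: le_trans.
apply: (@integral_lin_le _ _ _ mu _ (fun w => `|H w - X w| ^+ 2)
  (cst (e / 2))) => //.
- exact: measurable_abs_subX.
- exact: measurable_abs_subX.
- by rewrite invr_ge0 mulr_ge0 // ltW.
- by move=> w; rewrite divr_ge0 // ltW.
- move=> w; rewrite expr1 mul1r; move: (`|_|) => a.
  have : 0 <= (2 * e)^-1 * (a - e) ^+ 2.
    by rewrite mulr_ge0 ?sqr_ge0 // invr_ge0 mulr_ge0 // ltW.
  move=> hs; rewrite -subr_ge0; apply: le_trans hs _.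
  rewrite le_eqVlt; apply/orP; left; apply/eqP.
  by rewrite /=; field; rewrite gt_eqF.
- exact: h.
- by rewrite integral_probability_cst.
Qed.

(** The same function of approximations of the coordinates approximates
    [f X], with squared error at most [L^2] times the sum of theirs. *)
Lemma Lp_eps2_lipschitz (m : nat) (L : R) (f : 'rV[R]_m -> R)
    (X : Omega -> 'rV[R]_m) :
  0 <= L -> elipschitz L f -> (forall j, Lp_eps 2 (fun w => X w ord0 j)) ->
  Lp_eps 2 (fun w => f (X w)).
Proof.
move=> L0 fL hX.
have mX j : measurable_fun setT ((fun w => X w ord0 j) : Borel Omega -> R).
  by case: (hX j).
split; first exact: (measurable_lipschitz_comp L0 fL mX).
move=> e e0; pose e' := e / (L ^+ 2 * m%:R + 1).
have den0 : 0 < L ^+ 2 * m%:R + 1 by rewrite ltr_wpDl // mulr_ge0 // sqr_ge0.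
have /choice[H hH] : forall j, exists H, HbLip H /\ forall mu, P mu ->
    (\int[mu]_w (`|H w - X w ord0 j| ^+ 2)%:E <= e'%:E)%E.
  by move=> j; have [|H hH h] := (hX j).2 e'; [rewrite divr_gt0|exists H].
have fH : HbLip (fun w => f (\row_j H j w)).
  by apply: (HbLip_comp L0 fL) => j; case: (hH j).
exists (fun w => f (\row_j H j w)) => // mu Pmu.
have mH j : measurable_fun setT (H j : Borel Omega -> R).
  by apply: HbLip_measurable; case: (hH j).
have : m%:R * (L ^+ 2 * e') <= e.
  have -> : m%:R * (L ^+ 2 * e') = e * (L ^+ 2 * m%:R / (L ^+ 2 * m%:R + 1)).
    by rewrite /e'; field; rewrite gt_eqF.
  by rewrite ler_piMr ?ler_pdivrMr ?mul1r ?lerDl // ltW.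
rewrite -lee_fin; apply: le_trans.
apply: (@integral_sum_le _ _ _ mu m _
  (fun j w => L ^+ 2 * `|H j w - X w ord0 j| ^+ 2)).
- apply: measurable_abs_subX; first exact: HbLip_measurable.
  exact: (measurable_lipschitz_comp L0 fL mX).
- move=> j; apply: measurable_funM; first exact: measurable_cst.
  exact: measurable_abs_subX.
- by move=> w; rewrite exprn_ge0.
- by move=> j w; rewrite mulr_ge0 ?sqr_ge0.
- move=> w; apply: (@le_trans _ _ ((L * edist (\row_j H j w) (X w)) ^+ 2)).
    by rewrite lerXn2r ?nnegrE ?mulr_ge0 ?enorm_ge0 ?fL.
  rewrite exprMn enorm_sqr mulr_sumr; apply: ler_sum => j _.
  by rewrite !mxE real_normK ?num_real.
- move=> j; rewrite EFinM.
  rewrite [leLHS](_ : _ =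
      \int[mu]_w ((L ^+ 2)%:E * (`|H j w - X w ord0 j| ^+ 2)%:E))%E; last first.
    by apply: eq_integral => w _; rewrite EFinM.
  rewrite ge0_integralZl_EFin ?sqr_ge0 //.
  + have L20 : (0 <= (L ^+ 2)%:E)%E by rewrite lee_fin sqr_ge0.
    by rewrite lee_wpmul2l //; exact: (hH j).2.
  + by apply/measurable_EFinP; exact: measurable_abs_subX.
Qed.

Lemma Lp_eps1_integrable mu X : P mu -> Lp_eps 1 X ->
  mu.-integrable setT (EFin \o (X : Borel Omega -> R)).
Proof.
move=> Pmu [mX /(_ 1 ltr01)[H hH h]]; apply/integrableP; split.
  exact/measurable_EFinP.
have [M [_ [M0 _ hM _]]] := HbLipP hH; have mH := HbLip_measurable hH.
apply: (@le_lt_trans _ _ (1 * M + 1 * 1)%:E); last exact: ltry.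
apply: (@integral_lin_le _ _ _ mu _ (cst M)
  (fun w => `|H w - X w| ^+ 1)) => //=.
- exact: measurableT_comp.
- exact: measurable_abs_subX.
- move=> w; rewrite !mul1r expr1.
  by have := hM w; have := ler_normB (H w) (H w - X w); rewrite subKr; lra.
- by rewrite integral_probability_cst.
- exact: h.
Qed.

End Lp_theory.
(** * The extended sublinear expectation *)

Section extension.
Context {R : realType} {Omega : completeMetricType R}.
Variables (P : set (probability (Borel Omega) R)) (E0 : (Omega -> R) -> R).
Hypotheses (hP : represents P E0) (P0 : P !=set0).
Implicit Types X Y H : Omega -> R.

Lemma HbLip_Lp_eps H : HbLip H -> Lp_eps P 1 H.
Proof.
move=> hH; split; first exact: HbLip_measurable.
move=> e e0; exists H => // mu _; rewrite [leLHS](_ : _ = \int[mu]_w 0%:E)%E.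
  by rewrite integral_probability_cst lee_fin ltW.
by apply: eq_integral => w _; rewrite subrr normr0 expr1.
Qed.

Lemma integral_dist_le mu X Y (e : R) : P mu -> Lp_eps P 1 X -> Lp_eps P 1 Y ->
  (\int[mu]_w (`|Y w - X w| ^+ 1)%:E <= e%:E)%E ->
  (\int[mu]_w (X w)%:E <= \int[mu]_w (Y w)%:E + e%:E)%E.
Proof.
move=> Pmu X1 Y1 XYe.
have iX := Lp_eps1_integrable Pmu X1; have iY := Lp_eps1_integrable Pmu Y1.
have iD : mu.-integrable setT (EFin \o (fun w => `|Y w - X w|)).
  apply: (@integrable_norm _ _ _ mu _ (fun w => Y w - X w)).
  by have := integrableB measurableT iY iX; apply: eq_integrable.
apply: (@le_trans _ _ (\int[mu]_w ((Y w)%:E + (`|Y w - X w|)%:E))%E).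
  apply: le_integral => //; first exact: integrableD.
  move=> w _ /=; rewrite lee_fin.
  by have := ler_norm (X w - Y w); rewrite distrC; lra.
by rewrite integralD //; apply: leeD.
Qed.

Lemma Lp_eps1_upper_expectation X H (e : R) : Lp_eps P 1 X -> HbLip H ->
  (forall mu, P mu -> (\int[mu]_w (`|H w - X w| ^+ 1)%:E <= e%:E)%E) ->
  (upper_expectation P X <= (E0 H + e)%:E)%E /\
  ((E0 H - e)%:E <= upper_expectation P X)%E.
Proof.
move=> X1 hH h; have H1 := HbLip_Lp_eps hH; split.
  apply: upper_expectation_le => mu Pmu.
  apply: le_trans (integral_dist_le Pmu X1 H1 (h mu Pmu)) _.
  by rewrite EFinD (rep_sup hP hH) leeD2r // le_upper_expectation.
rewrite EFinB leeBlDr // (rep_sup hP hH).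
apply: upper_expectation_le => mu Pmu.
have h' : (\int[mu]_w (`|X w - H w| ^+ 1)%:E <= e%:E)%E.
  by under eq_integral do rewrite distrC; exact: h.
apply: le_trans (integral_dist_le Pmu H1 X1 h') _.
by rewrite leeD2r // le_upper_expectation.
Qed.

(** [extend] picks a limit along some approximating sequence. It is well defined
    because [E0] at an approximation within [e] of [X] is within [e] of the
    upper expectation of [X], which is therefore finite and the only limit. *)
Lemma extendE X : Lp_eps P 1 X -> (extend P E0 X)%:E = upper_expectation P X.
Proof.
move=> X1; have Ufin : upper_expectation P X \is a fin_num.
  case: X1 (X1) => _ /(_ 1 ltr01)[H hH h] X1.
  have [U1 U2] := Lp_eps1_upper_expectation X1 hH h.
  by rewrite fin_numElt (lt_le_trans _ U2) ?ltNyr //= (le_lt_trans U1) // ltry.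
set u := fine (upper_expectation P X).
have limE Xs : Lp_approx P 1 Xs X -> E0 (Xs k) @[k --> \oo] --> u.
  move=> [hXs Xs0]; apply/cvgrPdist_le => e e0.
  near=> k.
  have hk : (upper_norm P 1%:R (fun w => (Xs k w - X w)%R) < e%:E)%E.
    by near: k; exact: cvg0_lt_near.
  have hint := upper_norm_lt (ltn0Sn 0) (ltW e0) hk.
  have [] := Lp_eps1_upper_expectation X1 (hXs k) hint.
  rewrite -(fineK Ufin) !lee_fin -/u expr1 => h1 h2.
  by rewrite ler_norml; apply/andP; split; lra.
have : exists c, [set c : R | exists2 Xs, Lp_approx P 1 Xs X &
    E0 (Xs k) @[k --> \oo] --> c] c.
  have [_ [Xs hXs]] : Lp P 1%:R X by apply/Lp_epsP.
  by exists u, Xs => //; exact: limE.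
move=> /getPex[Xs hXs c_lim]; rewrite -(fineK Ufin); congr EFin.
exact: (cvg_unique (@Rhausdorff R) c_lim (limE _ hXs)).
Unshelve. all: by end_near. Qed.

Lemma Rintegral_le_extend mu X : P mu -> Lp_eps P 1 X ->
  \int[mu]_w X w <= extend P E0 X.
Proof.
move=> Pmu X1; rewrite -lee_fin extendE // fineK.
  exact: le_upper_expectation.
by apply: integrable_fin_num => //; exact: Lp_eps1_integrable X1.
Qed.

Lemma extend_le X (b : R) : Lp_eps P 1 X ->
  (forall mu, P mu -> \int[mu]_w X w <= b) -> extend P E0 X <= b.
Proof.
move=> X1 h; rewrite -lee_fin extendE //.
apply: upper_expectation_le => mu Pmu; have := h mu Pmu.
rewrite -lee_fin fineK //.
by apply: integrable_fin_num => //; exact: Lp_eps1_integrable X1.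
Qed.

End extension.

(** The supremum over an empty family would be [-oo], not the real [E0 0]. *)
Lemma represents_nonempty (R : realType) (Omega : completeMetricType R)
    (P : set (probability (Borel Omega) R)) (E0 : (Omega -> R) -> R) :
  represents P E0 -> P !=set0.
Proof.
move=> hP; apply/set0P/eqP => Pe.
have := rep_sup hP (HbLip_cst (Omega := Omega) 0).
by rewrite Pe /upper_expectation image_set0 ereal_sup0.
Qed.
(** * Minkowski sums of compact convex sets *)

Section minkowski.
Context {R : realType} {m : nat}.
Implicit Types (u v : 'rV[R]_m).

Lemma elipschitz_continuous (L : R) (f : 'rV[R]_m -> R) :
  0 <= L -> elipschitz L f -> continuous f.
Proof.
move=> L0 fL u; have FF : Filter (nbhs u) by exact: nbhs_filter.
apply/cvgrPdist_le => e e0.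
have den0 : 0 < L * m%:R + 1 by rewrite ltr_wpDl // mulr_ge0.
apply/(@nbhs_ballP R 'rV[R]_m u).
exists (e / (L * m%:R + 1)) => /=; first exact: divr_gt0.
move=> v [_ uv]; rewrite (le_trans (fL _ _)) //.
apply: (@le_trans _ _ (L * (m%:R * (e / (L * m%:R + 1))))).
  rewrite ler_wpM2l // (le_trans (enorm_le_sum _)) //.
  rewrite mulr_natl -[X in _ *+ X]card_ord -sumr_const.
  apply: ler_sum => j _; rewrite !mxE ltW //.
  by have := uv ord0 j; rewrite /ball /=.
have -> : L * (m%:R * (e / (L * m%:R + 1))) = e * (L * m%:R / (L * m%:R + 1)).
  by field; rewrite gt_eqF.
by rewrite ler_piMr ?ler_pdivrMr ?mul1r ?lerDl // ltW.
Qed.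

Lemma edist_elipschitz u : elipschitz 1 (edist u).
Proof.
move=> v w; rewrite mul1r (le_trans (enorm_dist _ _)) // /edist.
by rewrite opprB addrC addrA subrK enormB.
Qed.

Lemma dotv_elipschitz u : elipschitz (enorm u) (dotv u).
Proof.
move=> v w; rewrite /edist -dotvNr -dotvDr ler_norml dotv_le_enorm andbT.
by rewrite lerNl -dotvNr -[enorm (v - w)]enormN dotv_le_enorm.
Qed.

End minkowski.

Section set_sums.
Context {R : realType} {m n : nat}.
Variable T : 'I_n -> set 'rV[R]_m.

Definition sumset (k : nat) : set 'rV[R]_m :=
  [set \sum_(i < n | (i < k)%N) t i | t in [set t | forall i, T i (t i)]].

Lemma sum_ord_ltS (V : zmodType) (F : 'I_n -> V) (i : 'I_n) :
  \sum_(j < n | (j < i.+1)%N) F j = \sum_(j < n | (j < i)%N) F j + F i.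
Proof.
rewrite (bigD1 i) //= addrC; congr (_ + _); apply: eq_bigl => j.
by rewrite ltnS [RHS]ltn_neqAle andbC.
Qed.

Lemma sumsetS (i : 'I_n) a b : sumset i a -> T i b -> sumset i.+1 (a + b).
Proof.
move=> [t tT <-] Tb; exists (fun j => if j == i then b else t j).
  by move=> j /=; case: eqP => // ->.
rewrite sum_ord_ltS eqxx; congr (_ + _); apply: eq_bigr => j ji.
by rewrite -val_eqE ltn_eqF.
Qed.

Lemma sumset_nonempty k : (forall i, T i !=set0) -> sumset k !=set0.
Proof. by move=> /choice[t tT]; eexists; exists t. Qed.

Lemma sumset_convex k x y (a : R) :
  (forall i u v (b : R), T i u -> T i v -> 0 <= b <= 1 ->
    T i (u + b *: (v - u))) ->
  sumset k x -> sumset k y -> 0 <= a <= 1 -> sumset k (x + a *: (y - x)).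
Proof.
move=> cT [s sT <-] [t tT <-] a01; exists (fun i => s i + a *: (t i - s i)).
  by move=> i; exact: cT.
by rewrite big_split /= -scaler_sumr sumrB.
Qed.

(** The distance to a sum of compact sets is attained, as a minimum over the
    compact product of these sets. *)
Lemma sumset_nearest u : (forall i, compact (T i)) -> (forall i, T i !=set0) ->
  exists2 p, sumset n p & forall b, sumset n b -> edist u p <= edist u b.
Proof.
move=> cT T0; pose V := prod_topology (fun _ : 'I_n => 'rV[R]_m).
pose A : set V := [set t | forall i, T i (t i)].
have cA : compact A by exact: (@tychonoff _ (fun _ : 'I_n => 'rV[R]_m) T).
have A0 : A !=set0 by have /choice[t tT] := T0; exists t.
pose g (t : V) := edist u (\sum_(i < n | (i < n)%N) t i).
have cs : continuous (fun t : V => \sum_(i < n | (i < n)%N) t i).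
  apply: (@continuous_big 'rV[R]_m _ +%R) => [|i _].
    exact: add_continuous.
  exact: (@proj_continuous _ (fun _ : 'I_n => 'rV[R]_m) i).
have cg : continuous g.
  move=> t; apply: continuous_comp; first exact: cs.
  exact: (elipschitz_continuous ler01 (edist_elipschitz u)).
have [t tA tmin] := compact_EVT_min A0 cA (continuous_subspaceT cg).
exists (\sum_(i < n | (i < n)%N) t i); first by exists t => //; exact/set_mem.
by move=> _ [s sT <-]; apply: tmin; exact/mem_set.
Qed.

End set_sums.
(** * Random vectors in L^2 and their means *)

Section random_vectors.
Context {R : realType} {Omega : completeMetricType R}.
Variables (P : set (probability (Borel Omega) R)) (E0 : (Omega -> R) -> R).
Hypotheses (hP : represents P E0) (P0 : P !=set0).
Local Notation E := (extend P E0).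
Local Notation L1 := (Lp_eps P 1).
Local Notation L2 := (Lp_eps P 2).

Definition L2v m (V : Omega -> 'rV[R]_m) := forall j, L2 (fun w => V w ord0 j).

Lemma L2_cst (c : R) : L2 (fun _ => c).
Proof.
apply: (@Lp_eps2_lipschitz _ _ P 0 0 (fun _ => c) (fun _ => 0)) => //.
  by move=> u v; rewrite subrr normr0 mul0r.
by case.
Qed.

Lemma L2_add X Y : L2 X -> L2 Y -> L2 (fun w => X w + Y w).
Proof.
move=> hX hY.
pose f (u : 'rV[R]_2) := u ord0 ord0 + u ord0 (lift ord0 ord0).
pose V w : 'rV[R]_2 := \row_b (if b == ord0 then X w else Y w).
have -> : (fun w => X w + Y w) = (fun w => f (V w)).
  by apply/funext => w; rewrite /f !mxE.
apply: (@Lp_eps2_lipschitz _ _ P 2 2) => //.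
  move=> u v; rewrite /f opprD addrACA (le_trans (ler_normD _ _)) //.
  rewrite mulr_natl mulr2n.
  have := coord_le_enorm (u - v) ord0.
  have := coord_le_enorm (u - v) (lift ord0 ord0).
  by rewrite !mxE => h1 h2; exact: lerD.
move=> b; have [->|b0] := eqVneq b ord0.
  by rewrite (_ : (fun _ => _) = X) //; apply/funext => w; rewrite !mxE.
rewrite (_ : (fun _ => _) = Y) //; apply/funext => w.
by rewrite !mxE (negbTE b0).
Qed.

Lemma L2v_lipschitz m (L : R) (f : 'rV[R]_m -> R) V : 0 <= L ->
  elipschitz L f -> L2v V -> L2 (fun w => f (V w)).
Proof. by move=> L0 fL hV; exact: Lp_eps2_lipschitz L0 fL hV. Qed.

Lemma L2v_add m (V W : Omega -> 'rV[R]_m) : L2v V -> L2v W ->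
  L2v (fun w => V w + W w).
Proof.
move=> hV hW j; rewrite (_ : (fun _ => _) = (fun w => V w ord0 j + W w ord0 j)).
  exact: L2_add.
by apply/funext => w; rewrite mxE.
Qed.

Lemma L2v_cst m (x : 'rV[R]_m) : L2v (fun _ => x).
Proof. by move=> j; exact: L2_cst. Qed.

Lemma L2v_sum m (n : nat) (Q : pred 'I_n) (V : 'I_n -> Omega -> 'rV[R]_m) :
  (forall i, L2v (V i)) -> L2v (fun w => \sum_(i | Q i) V i w).
Proof.
move=> hV; elim: (index_enum _) => [|i s IH].
  rewrite (_ : (fun _ => _) = (fun _ => 0)); first exact: L2v_cst.
  by apply/funext => w; rewrite big_nil.
have [Qi|Qi] := boolP (Q i).
  rewrite (_ : (fun _ => _) = (fun w => V i w + \sum_(j <- s | Q j) V j w)).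
    by apply: L2v_add; [exact: hV|exact: IH].
  by apply/funext => w; rewrite big_cons Qi.
rewrite (_ : (fun _ => _) = (fun w => \sum_(j <- s | Q j) V j w)) //.
by apply/funext => w; rewrite big_cons (negbTE Qi).
Qed.

Lemma L2v_row_mx m1 m2 (V : Omega -> 'rV[R]_m1) (W : Omega -> 'rV[R]_m2) :
  L2v V -> L2v W -> L2v (fun w => row_mx (V w) (W w)).
Proof.
move=> hV hW j; case: (split_ordP j) => k ->.
  rewrite (_ : (fun _ => _) = (fun w => V w ord0 k)) //.
  by apply/funext => w; rewrite row_mxEl.
rewrite (_ : (fun _ => _) = (fun w => W w ord0 k)) //.
by apply/funext => w; rewrite row_mxEr.
Qed.

Lemma L1_dotv m (u : 'rV[R]_m) V : L2v V -> L1 (fun w => dotv u (V w)).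
Proof.
move=> hV; apply: Lp_eps2_1.
exact: (L2v_lipschitz (enorm_ge0 u) (dotv_elipschitz u)).
Qed.

Lemma L1_enorm_sqr m V (x : 'rV[R]_m) : L2v V ->
  L1 (fun w => enorm (V w - x) ^+ 2).
Proof.
move=> hV; apply: Lp_eps_sqr.
rewrite (_ : (fun _ => _) = (fun w => edist x (V w))).
  exact: (L2v_lipschitz ler01 (edist_elipschitz x)).
by apply/funext => w; rewrite enormB.
Qed.

Lemma L1_setdist_sqr m A (V : Omega -> 'rV[R]_m) : A !=set0 -> L2v V ->
  L1 (fun w => setdist A (V w) ^+ 2).
Proof.
move=> A0 hV; apply: Lp_eps_sqr.
exact: (L2v_lipschitz ler01 (setdist_lipschitz A0)).
Qed.

Definition mean m (mu : probability (Borel Omega) R) (V : Omega -> 'rV[R]_m) :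
  'rV[R]_m := \row_j \int[mu]_w V w ord0 j.

Lemma Rintegral_dotv m mu (u : 'rV[R]_m) V : P mu -> L2v V ->
  \int[mu]_w dotv u (V w) = dotv u (mean mu V).
Proof.
move=> Pmu hV.
have iV j : mu.-integrable setT (EFin \o (fun w : Borel Omega => V w ord0 j)).
  exact: Lp_eps1_integrable Pmu (Lp_eps2_1 (hV j)).
have iuV j : mu.-integrable setT
    (EFin \o (fun w : Borel Omega => u ord0 j * V w ord0 j)).
  have := integrableZl measurableT (u ord0 j) (iV j).
  by apply: eq_integrable => // w _ /=; rewrite EFinM.
rewrite /Rintegral; under eq_integral do rewrite -sumEFin.
rewrite integral_sum //= (eq_bigr (fun j => (u ord0 j * mean mu V ord0 j)%:E)).
  by rewrite sumEFin.
move=> j _; rewrite mxE -RintegralZl // fineK //.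
by apply: integrable_fin_num => //; exact: iuV.
Qed.

(** Under each [mu], the mean [q] of [Z = V - th] minimises the variance:
    expanding [|p + Z - q|^2 = |p - q|^2 + 2 <p - q, Z> + |Z|^2] and
    integrating leaves [|p|^2 - |q|^2] plus the integral of [|Z|^2]. *)
Lemma Rintegral_centered_le m mu (p th : 'rV[R]_m) V : P mu -> L2v V ->
  \int[mu]_w (enorm (V w - (mean mu V - p)) ^+ 2) <=
  enorm p ^+ 2 + E (fun w => enorm (V w - th) ^+ 2).
Proof.
move=> Pmu hV; set b := p - (mean mu V - th).
have i2 := Lp_eps1_integrable Pmu (L1_enorm_sqr th hV).
have i1 := Lp_eps1_integrable Pmu (L1_dotv (2 *: b) hV).
pose c := enorm b ^+ 2 - dotv (2 *: b) th.
have ic : mu.-integrable setT (EFin \o (fun _ : Borel Omega => c)).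
  exact: Lp_eps1_integrable Pmu (Lp_eps2_1 (L2_cst c)).
have i12 : mu.-integrable setT (EFin \o (fun w : Borel Omega =>
    dotv (2 *: b) (V w) + c)).
  by have := integrableD measurableT i1 ic; apply: eq_integrable.
have -> : \int[mu]_w (enorm (V w - (mean mu V - p)) ^+ 2) =
    \int[mu]_w ((dotv (2 *: b) (V w) + c) + enorm (V w - th) ^+ 2).
  apply: eq_Rintegral => w _.
  have -> : V w - (mean mu V - p) = b + (V w - th).
    by apply/rowP => j; rewrite !mxE; ring.
  by rewrite /c enormD_sqr dotvDr dotvNr !dotvZl; ring.
rewrite RintegralD // RintegralD // Rintegral_dotv //.
have := Rintegral_le_extend hP P0 Pmu (L1_enorm_sqr th hV).
rewrite Rintegral_probability_cst.
have -> : enorm p ^+ 2 =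
    enorm b ^+ 2 + 2 * dotv b (mean mu V - th) + enorm (mean mu V - th) ^+ 2.
  by rewrite -enormD_sqr subrK.
have -> : dotv (2 *: b) (mean mu V) =
    2 * dotv b (mean mu V - th) + dotv (2 *: b) th.
  by rewrite -dotvZl -dotvDr subrK.
have := sqr_ge0 (enorm (mean mu V - th)); rewrite /c; lra.
Qed.

End random_vectors.
(** * One step under independence *)

Section truncation.
Context {R : realType} {m : nat}.
Implicit Types (g : 'rV[R]_m -> R) (N L : R).

Lemma elipschitz_minr L g N : 0 <= L -> elipschitz L g ->
  elipschitz L (fun v => Num.min (g v) N).
Proof.
move=> L0 gL u v; have := gL u v.
have Luv : 0 <= L * edist u v by rewrite mulr_ge0 ?enorm_ge0.
rewrite !ler_norml => /andP[h1 h2].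
by case: (leP (g u) N) => h3; case: (leP (g v) N) => h4;
  apply/andP; split; lra.
Qed.

Lemma minr_sqr_lipschitz L g N : 0 <= N -> 0 <= L -> (forall v, 0 <= g v) ->
  elipschitz L g -> elipschitz (L * (2 * N)) (fun v => Num.min (g v) N ^+ 2).
Proof.
move=> N0 L0 g0 gL u v; rewrite subr_sqr normrM mulrAC.
apply: ler_pM => //; first exact: elipschitz_minr.
have h w : 0 <= Num.min (g w) N <= N.
  by rewrite le_min g0 N0 ge_min lexx orbT.
have /andP[u1 u2] := h u; have /andP[v1 v2] := h v.
by rewrite ger0_norm ?addr_ge0 //; lra.
Qed.

Lemma minr_sqr_bLip L g N : 0 <= N -> 0 <= L -> (forall v, 0 <= g v) ->
  elipschitz L g -> bLip edist (fun v => Num.min (g v) N ^+ 2).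
Proof.
move=> N0 L0 g0 gL; split; last first.
  by exists (L * (2 * N));
  exact: minr_sqr_lipschitz.
exists (N ^+ 2) => v; rewrite ger0_norm ?sqr_ge0 //.
by rewrite lerXn2r ?nnegrE ?le_min ?g0 ?N0 // ge_min lexx orbT.
Qed.

End truncation.

Section row_mx_norm.
Context {R : realType} {m1 m2 : nat}.
Implicit Types (u : 'rV[R]_m1) (v : 'rV[R]_m2) (z : 'rV[R]_(m1 + m2)).

Lemma enorm_row_mx_sqr u v :
  enorm (row_mx u v) ^+ 2 = enorm u ^+ 2 + enorm v ^+ 2.
Proof.
rewrite !enorm_sqr /dotv big_split_ord /=.
by congr (_ + _); apply: eq_bigr => j _; rewrite ?row_mxEl ?row_mxEr.
Qed.

Lemma enorm_lsubmx z : enorm (lsubmx z) <= enorm z.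
Proof.
rewrite -(@ler_pXn2r _ 2) ?nnegrE ?enorm_ge0 // -{2}[z]hsubmxK.
by rewrite enorm_row_mx_sqr lerDl sqr_ge0.
Qed.

Lemma enorm_rsubmx z : enorm (rsubmx z) <= enorm z.
Proof.
rewrite -(@ler_pXn2r _ 2) ?nnegrE ?enorm_ge0 // -{2}[z]hsubmxK.
by rewrite enorm_row_mx_sqr lerDr sqr_ge0.
Qed.

Lemma edist_row_mxl u u' v : edist (row_mx u v) (row_mx u' v) = edist u u'.
Proof.
rewrite /edist opp_row_mx add_row_mx subrr /enorm /dotv big_split_ord /=.
rewrite addrC big1 ?add0r => [|j _]; last by rewrite row_mxEr mxE mul0r.
by congr Num.sqrt; apply: eq_bigr => j _; rewrite row_mxEl.
Qed.

End row_mx_norm.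

Section recursion.
Context {R : realType} {Omega : completeMetricType R}.
Variables (P : set (probability (Borel Omega) R)) (E0 : (Omega -> R) -> R).
Hypotheses (hP : represents P E0) (P0 : P !=set0).
Local Notation E := (extend P E0).
Local Notation L1 := (Lp_eps P 1).
Local Notation L2 := (Lp_eps P 2).
Local Notation L2v := (L2v P).

Lemma extend_le_cst X Y (c : R) : L1 X -> L1 Y ->
  (forall w, X w <= Y w + c) -> E X <= E Y + c.
Proof.
move=> hX hY XY; apply: (extend_le hP P0 hX) => mu Pmu.
have iX := Lp_eps1_integrable Pmu hX; have iY := Lp_eps1_integrable Pmu hY.
have ic : mu.-integrable setT (EFin \o (fun _ : Borel Omega => c)).
  exact: Lp_eps1_integrable Pmu (Lp_eps2_1 (L2_cst P c)).
apply: (@le_trans _ _ (\int[mu]_w (Y w + c))).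
  apply: le_Rintegral => //.
  by have := integrableD measurableT iY ic; apply: eq_integrable.
rewrite RintegralD // Rintegral_probability_cst lerD2r.
exact: (Rintegral_le_extend hP P0).
Qed.

(** The truncation error tends to 0 uniformly over [P], because [g^2] is an L^1
    limit of bounded functions. *)
Lemma extend_truncation m (L : R) (g : 'rV[R]_m -> R) V (b : R) :
  0 <= L -> (forall v, 0 <= g v) -> elipschitz L g -> L2v V ->
  (forall N : nat, E (fun w => Num.min (g (V w)) N%:R ^+ 2) <= b) ->
  E (fun w => g (V w) ^+ 2) <= b.
Proof.
move=> L0 g0 gL hV h.
have g2 : L1 (fun w => g (V w) ^+ 2).
  by apply: Lp_eps_sqr; exact: (L2v_lipschitz L0 gL).
apply: (extend_le hP P0 g2) => mu Pmu; apply/ler_addgt0Pr => e e0.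
(* beyond the bound [N] of a bounded approximation [H] of [g^2], the
   truncation error [g^2 - N^2] is at most [|H - g^2|] *)
have [H hH Hg] := g2.2 e e0.
have [M [_ [M0 _ hM _]]] := HbLipP hH.
pose N := (Num.truncn M).+1; have MN : M <= N%:R by rewrite ltW // truncnS_gt.
have hm : L1 (fun w => Num.min (g (V w)) N%:R ^+ 2).
  apply: Lp_eps2_1.
  apply: (L2v_lipschitz _ (minr_sqr_lipschitz _ L0 g0 gL)) => //.
  by rewrite !mulr_ge0.
have im := Lp_eps1_integrable Pmu hm; have ig := Lp_eps1_integrable Pmu g2.
have iH := Lp_eps1_integrable Pmu (HbLip_Lp_eps P hH).
have iHg : mu.-integrable setT
    (EFin \o (fun w : Borel Omega => `|H w - g (V w) ^+ 2|)).
  apply: (@integrable_norm _ _ _ mu _ (fun w => H w - g (V w) ^+ 2)).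
  by have := integrableB measurableT iH ig; apply: eq_integrable.
apply: (@le_trans _ _ (\int[mu]_w
    (Num.min (g (V w)) N%:R ^+ 2 + `|H w - g (V w) ^+ 2|))).
  apply: le_Rintegral => //.
    by have := integrableD measurableT im iHg; apply: eq_integrable.
  move=> w _; have [gN|Ng] := leP (g (V w)) N%:R; first by rewrite lerDl.
  have := hM w; rewrite ler_norml => /andP[_ HM].
  have N1 : 1 <= N%:R :> R by rewrite ler1n.
  have NN : N%:R <= N%:R ^+ 2 :> R by rewrite expr2 ler_peMr.
  by have := ler_norm (g (V w) ^+ 2 - H w); rewrite distrC; lra.
rewrite RintegralD //; apply: lerD.
  exact: le_trans (Rintegral_le_extend hP P0 Pmu hm) (h N).
rewrite -lee_fin fineK; last by apply: integrable_fin_num => //; exact: iHg.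
exact: Hg mu Pmu.
Qed.

Variable (d : nat).
Implicit Types (A B : set 'rV[R]_d) (V : Omega -> 'rV[R]_d).

(** For each [a] of [A], the point [a + mean mu V] competes for the distance on
    the left. *)
Lemma Rintegral_setdist_le mu A B V (x th : 'rV[R]_d) :
  P mu -> A !=set0 -> B (mean mu V) -> L2v V ->
  \int[mu]_w setdist [set a + b | a in A & b in B] (x + V w) ^+ 2 <=
  setdist A x ^+ 2 + E (fun w => enorm (V w - th) ^+ 2).
Proof.
move=> Pmu A0 Bmean hV; apply: le_setdist_sqr => // a Aa.
have AB0 : [set a + b | a in A & b in B] !=set0.
  by exists (a + mean mu V); exists a => //; exists (mean mu V).
apply: le_trans (Rintegral_centered_le hP P0 (x - a) th Pmu hV).
apply: le_Rintegral => //.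
- apply: Lp_eps1_integrable Pmu _.
  by apply: L1_setdist_sqr => //; apply: L2v_add => //; exact: L2v_cst.
- by apply: Lp_eps1_integrable Pmu _; exact: L1_enorm_sqr.
move=> w _; rewrite lerXn2r ?nnegrE ?enorm_ge0 ?setdist_ge0 //.
apply: (@le_trans _ _ (edist (x + V w) (a + mean mu V))).
  by apply: setdist_le; exists a => //; exists (mean mu V).
rewrite /edist le_eqVlt; apply/orP; left; apply/eqP; congr enorm.
by apply/rowP => j; rewrite !mxE; ring.
Qed.

(** Independence reduces the joint law of [Y] and [V] to the law of [V] with
    [Y] frozen, to which the previous lemma applies; [F Y] stands for the sum of
    the variables that are listed in [Y]. *)
Lemma extend_setdist_independent_le m (Y : Omega -> 'rV[R]_m) V
    (F : 'rV[R]_m -> 'rV[R]_d) (C : R) A B (th : 'rV[R]_d) :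
  L2v Y -> L2v V -> independent_of E V Y ->
  0 <= C -> (forall u v, enorm (F u - F v) <= C * edist u v) ->
  A !=set0 -> (forall mu, P mu -> B (mean mu V)) ->
  E (fun w => setdist [set a + b | a in A & b in B] (F (Y w) + V w) ^+ 2) <=
  E (fun w => setdist A (F (Y w)) ^+ 2) + E (fun w => enorm (V w - th) ^+ 2).
Proof.
move=> hY hV ind C0 FC A0 hB; set AB := [set a + b | a in A & b in B].
have AB0 : AB !=set0.
  by have [mu Pmu] := P0; have [a Aa] := A0; exists (a + mean mu V), a => //;
    exists (mean mu V) => //; exact: hB.
set c := E (fun w => enorm (V w - th) ^+ 2).
pose g (z : 'rV[R]_(m + d)) := setdist AB (F (lsubmx z) + rsubmx z).
have g0 z : 0 <= g z by exact: setdist_ge0.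
have C10 : 0 <= C + 1 by rewrite addr_ge0.
have gL : elipschitz (C + 1) g.
  move=> y z; rewrite (le_trans (setdist_lipschitz AB0 _ _)) // mul1r.
  rewrite /edist opprD addrACA (le_trans (enormD _ _)) // mulrDl mul1r lerD //.
    rewrite (le_trans (FC _ _)) // ler_wpM2l // /edist -linearB.
    exact: enorm_lsubmx.
  by rewrite -linearB; exact: enorm_rsubmx.
have gE y v : g (row_mx y v) = setdist AB (F y + v).
  by rewrite /g row_mxKl row_mxKr.
rewrite (_ : (fun _ => _) = (fun w => g (row_mx (Y w) (V w)) ^+ 2)); last first.
  by apply/funext => w; rewrite gE.
have FA : elipschitz C (fun y => setdist A (F y)).
  by move=> u v; rewrite (le_trans (setdist_lipschitz A0 _ _)) // mul1r FC.
have hFA : L1 (fun w => setdist A (F (Y w)) ^+ 2).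
  by apply: Lp_eps_sqr; exact: (L2v_lipschitz C0 FA).
apply: (extend_truncation C10 g0 gL); first exact: L2v_row_mx.
move=> N; pose psi z := Num.min (g z) N%:R ^+ 2.
pose K := (C + 1) * (2 * N%:R : R).
have K0 : 0 <= K by rewrite !mulr_ge0.
have psiL : elipschitz K psi by exact: minr_sqr_lipschitz.
have psi1 y : L1 (fun w => psi (row_mx y (V w))).
  apply: Lp_eps2_1.
  apply: (L2v_lipschitz K0 psiL (V := fun w => row_mx y (V w))).
  by apply: L2v_row_mx => //; exact: L2v_cst.
rewrite -/(psi _) (ind psi (minr_sqr_bLip _ C10 g0 gL)) //.
apply: (@extend_le_cst _ _ c) => //.
  apply: Lp_eps2_1.
  apply: (L2v_lipschitz K0
    (f := fun y => E (fun w => psi (row_mx y (V w))))) => //.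
  have h y z : E (fun w => psi (row_mx y (V w))) <=
      E (fun w => psi (row_mx z (V w))) + K * edist y z.
    apply: extend_le_cst => // w; rewrite -lerBlDl (le_trans (ler_norm _)) //.
    by rewrite (le_trans (psiL _ _)) // edist_row_mxl.
  move=> y z; rewrite ler_norml lerBlDl h andbT lerNl opprB lerBlDl.
  by rewrite /edist enormB h.
move=> w; apply: (extend_le hP P0) => // mu Pmu.
apply: le_trans (Rintegral_setdist_le (F (Y w)) th Pmu A0 (hB mu Pmu) hV).
apply: le_Rintegral => //; first exact: Lp_eps1_integrable Pmu (psi1 _).
  apply: Lp_eps1_integrable Pmu _; apply: L1_setdist_sqr => //.
  by apply: L2v_add => //; exact: L2v_cst.
move=> w' _; rewrite /psi gE lerXn2r ?nnegrE ?setdist_ge0 //.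
  by rewrite le_min setdist_ge0 //= ler0n.
by rewrite ge_min lexx.
Qed.

End recursion.
(** * The sets of means *)

Section means.
Context {R : realType} {Omega : completeMetricType R}.
Variables (P : set (probability (Borel Omega) R)) (E0 : (Omega -> R) -> R).
Hypotheses (hP : represents P E0) (P0 : P !=set0).
Variables (d n : nat) (X : 'I_n -> Omega -> 'rV[R]_d).
Hypothesis hX : forall i, L2v P (X i).
Local Notation E := (extend P E0).
Local Notation Th := (Theta_i E X).

Lemma mean_Theta mu i : P mu -> Th i (mean mu (X i)).
Proof.
move=> Pmu p; rewrite dotvC -(Rintegral_dotv p Pmu (hX i)).
by apply: (Rintegral_le_extend hP P0) => //; exact: L1_dotv.
Qed.

Lemma Theta_i_nonempty i : Th i !=set0.
Proof. by have [mu Pmu] := P0; exists (mean mu (X i)); exact: mean_Theta. Qed.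

Lemma Theta_i_convex i u v (a : R) : Th i u -> Th i v -> 0 <= a <= 1 ->
  Th i (u + a *: (v - u)).
Proof.
move=> hu hv /andP[a0 a1] p; rewrite dotvDl dotvZl dotvDl dotvNl.
have : (1 - a) * dotv u p <= (1 - a) * E (fun w => dotv p (X i w)).
  by rewrite ler_wpM2l ?subr_ge0.
have : a * dotv v p <= a * E (fun w => dotv p (X i w)) by rewrite ler_wpM2l.
lra.
Qed.

(** Closed as an intersection of half-spaces, bounded because the directions
    [p] range over both signs of each basis vector. *)
Lemma Theta_i_compact i : compact (Th i).
Proof.
apply: bounded_closed_compact.
  pose B (s : R) j := E (fun w => dotv (s *: delta_mx ord0 j) (X i w)).
  exists (\sum_j (`|B 1 j| + `|B (-1) j|)); split; first exact: num_real.
  move=> M hM th hth /=; rewrite [leLHS]/Num.Def.normr /= mx_normrE.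
  have s0 j : 0 <= `|B 1 j| + `|B (-1) j| by rewrite addr_ge0.
  apply: bigmax_le => [|[k j] _ /=].
    by rewrite (le_trans _ (ltW hM)) // sumr_ge0.
  rewrite (ord1 k) (le_trans _ (ltW hM)) // (bigD1 j) //= ler_wpDr ?sumr_ge0 //.
  have dE (s : R) : dotv th (s *: delta_mx ord0 j) = s * th ord0 j.
    rewrite dotvZr /dotv (bigD1 j) //= mxE !eqxx mulr1 big1 ?addr0 // => l lj.
    by rewrite mxE (negbTE lj) andbF mulr0.
  have h1 := hth (1 *: delta_mx ord0 j); have h2 := hth (-1 *: delta_mx ord0 j).
  rewrite dE mul1r -/(B 1 j) in h1; rewrite dE mulN1r -/(B (-1) j) in h2.
  move: (B 1 j) (B (-1) j) (th ord0 j) h1 h2 => b c t tb tc.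
  rewrite ler_norml; have := ler_norm b; have := ler_norm c.
  by have := normr_ge0 b; have := normr_ge0 c => *; apply/andP; split; lra.
rewrite (_ : Th i = \bigcap_(p in [set: 'rV[R]_d])
    [set th | dotv p th <= E (fun w => dotv p (X i w))]).
  apply: closed_bigI => p _.
  apply: (@preimage_closed _ _ (dotv p) [set x : R | x <= _]); last first.
    exact: closed_le.
  move=> x _; exact: (elipschitz_continuous (enorm_ge0 p) (dotv_elipschitz p)).
apply/seteqP; split => th h p; first by move=> _; rewrite /= dotvC; exact: h.
by rewrite dotvC; exact: (h p).
Qed.

End means.

Section initial.
Context {R : realType} {d k : nat}.

(** [initial_vars] flattens a matrix whose rows are the earlier variables;
    this linear map recovers their sum. *)
Definition sum_rows (u : 'rV[R]_(k * d)) : 'rV[R]_d :=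
  \sum_(l < k) row l (vec_mx u).

Lemma sum_rows_lipschitz u v :
  enorm (sum_rows u - sum_rows v) <= (k * d)%:R * edist u v.
Proof.
rewrite /sum_rows -sumrB (le_trans (enorm_sum _)) //.
rewrite natrM -mulrA mulr_natl -[X in _ *+ X]card_ord -sumr_const.
apply: ler_sum => l _; rewrite (le_trans (enorm_le_sum _)) //.
rewrite mulr_natl -[X in _ *+ X]card_ord -sumr_const.
apply: ler_sum => j _; rewrite !mxE.
by have := coord_le_enorm (u - v) (mxvec_index l j); rewrite !mxE.
Qed.

End initial.

Lemma sum_rows_initial_vars (R : realType) (Omega : completeMetricType R)
    (d n : nat) (X : 'I_n -> Omega -> 'rV[R]_d) (i : 'I_n) w :
  sum_rows (initial_vars X i w) = \sum_(j < n | (j < i)%N) X j w.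
Proof.
rewrite (big_ord_narrow (ltnW (ltn_ord i))); apply: eq_bigr => l _.
by rewrite mxvecK; apply/rowP => j; rewrite !mxE.
Qed.

Lemma L2v_initial_vars (R : realType) (Omega : completeMetricType R)
    (P : set (probability (Borel Omega) R)) (d n : nat)
    (X : 'I_n -> Omega -> 'rV[R]_d) (i : 'I_n) :
  (forall j, L2v P (X j)) -> L2v P (initial_vars X i).
Proof.
move=> hX j; case/mxvec_indexP: j => l j.
rewrite (_ : (fun _ => _) =
    (fun w => X (widen_ord (ltnW (ltn_ord i)) l) w ord0 j)); first exact: hX.
by apply/funext => w; rewrite mxvecE mxE.
Qed.

(** * The law of large numbers *)

Section partial_sums.
Context {R : realType} {Omega : completeMetricType R}.
Variables (P : set (probability (Borel Omega) R)) (E0 : (Omega -> R) -> R).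
Hypotheses (hP : represents P E0) (P0 : P !=set0).
Variables (d n : nat) (X : 'I_n -> Omega -> 'rV[R]_d).
Hypothesis hX : forall i, L2v P (X i).
Local Notation E := (extend P E0).
Local Notation Th := (Theta_i E X).
Hypothesis hind : independent_seq E X.

(** Induction on [k]: the first variable is treated unconditionally, and each
    later one given [initial_vars]. *)
Lemma extend_setdist_partial_sum_le (th : 'I_n -> 'rV[R]_d) k : (k <= n)%N ->
  E (fun w => setdist (sumset Th k) (\sum_(i < n | (i < k)%N) X i w) ^+ 2) <=
  \sum_(i < n | (i < k)%N) E (fun w => enorm (X i w - th i) ^+ 2).
Proof.
have K0 l : sumset Th l !=set0.
  by apply: sumset_nonempty => i; exact: Theta_i_nonempty.
have S2 l : L2v P (fun w => \sum_(i < n | (i < l)%N) X i w) by exact: L2v_sum.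
elim: k => [_|k IH kn].
  rewrite big_pred0_eq; apply: (extend_le hP P0); first exact: L1_setdist_sqr.
  move=> mu Pmu; rewrite -[leRHS](Rintegral_probability_cst mu).
  rewrite le_eqVlt; apply/orP; left; apply/eqP; apply: eq_Rintegral => w _.
  have [_ [t tT _]] := K0 0%N.
  have d0 : setdist (sumset Th 0) 0 <= 0.
    have T0 : sumset Th 0 0 by exists t => //; rewrite big_pred0_eq.
    by rewrite (le_trans (setdist_le _ T0)) // /edist subrr /enorm /dotv
      big1 ?sqrtr0 // => j _; rewrite mxE mul0r.
  rewrite big_pred0_eq; apply/eqP; rewrite sqrf_eq0 eq_le d0 /=.
  exact: setdist_ge0.
pose i := Ordinal kn; rewrite -[k]/(nat_of_ord i) sum_ord_ltS.
under eq_fun do rewrite sum_ord_ltS.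
set AB := [set a + b | a in sumset Th i & b in Th i].
have AB0 : AB !=set0.
  have [a Aa] := K0 i; have [b Bb] := Theta_i_nonempty hP P0 hX i.
  by exists (a + b), a => //; exists b.
have hB mu : P mu -> Th i (mean mu (X i)) by exact: mean_Theta.
have SX : L2v P (fun w => \sum_(j < n | (j < i)%N) X j w + X i w).
  exact: L2v_add.
apply: (@le_trans _ _ (E (fun w =>
    setdist AB (\sum_(j < n | (j < i)%N) X j w + X i w) ^+ 2))).
  rewrite -[leRHS]addr0; apply: (extend_le_cst hP P0).
  - exact: L1_setdist_sqr.
  - exact: L1_setdist_sqr.
  move=> w; rewrite addr0 lerXn2r ?nnegrE ?setdist_ge0 //.
  apply: le_setdist => // _ [a Aa [b Bb <-]].
  by apply: setdist_le; exact: sumsetS.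
apply: (@le_trans _ _ (E (fun w =>
    setdist (sumset Th i) (\sum_(j < n | (j < i)%N) X j w) ^+ 2) +
    E (fun w => enorm (X i w - th i) ^+ 2))); last first.
  by rewrite lerD2r; exact: IH (ltnW kn).
have [i0|i0] := posnP i.
  (* the earlier sum is the constant 0, so there is nothing to freeze *)
  have S0 w : \sum_(j < n | (j < i)%N) X j w = 0.
    by apply: big_pred0 => j; rewrite i0.
  apply: (extend_le hP P0) => [|mu Pmu]; first exact: L1_setdist_sqr.
  under eq_Rintegral do rewrite S0.
  have hdist :=
    Rintegral_setdist_le hP P0 _ (th i) Pmu (K0 i) (hB _ Pmu) (hX i).
  rewrite (le_trans (hdist _)) //.
  rewrite lerD2r (_ : (fun _ => _) = (fun _ => setdist (sumset Th i) 0 ^+ 2)).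
    rewrite -[leLHS](Rintegral_probability_cst mu).
    by apply: (Rintegral_le_extend hP P0) => //; exact/Lp_eps2_1/L2_cst.
  by apply/funext => w; rewrite S0.
have SE w := sum_rows_initial_vars X i w.
rewrite (_ : (fun w => setdist AB _ ^+ 2) = (fun w =>
    setdist AB (sum_rows (initial_vars X i w) + X i w) ^+ 2)); last first.
  by apply/funext => w; rewrite SE.
rewrite (_ : (fun w => setdist (sumset _ _) _ ^+ 2) = (fun w =>
    setdist (sumset Th i) (sum_rows (initial_vars X i w)) ^+ 2)); last first.
  by apply/funext => w; rewrite SE.
apply: (extend_setdist_independent_le hP P0 (F := sum_rows)
  (C := (i * d)%:R) (B := Th i) (A := sumset Th i) (th i)).
- exact: L2v_initial_vars.
- exact: hX.
- exact: hind.
- exact: ler0n.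
- by move=> u v; exact: sum_rows_lipschitz.
- exact: K0.
- exact: hB.
Qed.

End partial_sums.
Theorem theorem3p4 (R : realType) (Omega : completeMetricType R)
    (hOmega : separable_space Omega)
    (E0 : (Omega -> R) -> R) (hE0 : regular_sublinear E0)
    (P : set (probability (Borel Omega) R)) (hP : represents P E0)
    (d n : nat) (hd : (1 <= d)%N) (hn : (1 < n)%N)
    (X : 'I_n -> Omega -> 'rV[R]_d)
    (hX : forall i, Lpv P 2 (X i))
    (hindep : independent_seq (extend P E0) X) :
  let E := extend P E0 in
  (ereal_inf [set (E (fun w =>
                      enorm (n%:R^-1 *: \sum_(i < n) X i w - xi w) ^+ 2))%:E
             | xi in L2_valued P (Theta E X)]
   <= sigma2 E X * (n%:R^-1)%:E)%E.
Proof.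
cbv zeta; set E := extend P E0; have P0 := represents_nonempty hP.
have X2 i : L2v P (X i).
  by move=> j; apply/(Lp_epsP P0 _ (ltn0Sn 1)); exact: hX.
have n0 : (0 < n)%N by exact: ltnW.
have nR : 0 < n%:R^-1 :> R by rewrite invr_gt0 ltr0n.
set K := sumset (Theta_i E X) n.
have K0 : K !=set0 by apply: sumset_nonempty => i; exact: Theta_i_nonempty.
have nearE u : exists2 p, K p & forall b, K b -> edist u p <= edist u b.
  apply: sumset_nearest => i; first exact: Theta_i_compact.
  exact: Theta_i_nonempty.
have cK x y (t : R) : K x -> K y -> 0 <= t <= 1 -> K (x + t *: (y - x)).
  by apply: sumset_convex => i u v b; exact: Theta_i_convex.
have nearK u : K (nearest K u) /\
    forall b, K b -> edist u (nearest K u) <= edist u b.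
  exact: nearestP (nearE u).
pose S w := \sum_(i < n) X i w.
have S2 : L2v P S by exact: L2v_sum.
have sumE (V : zmodType) (F : 'I_n -> V) :
    \sum_(i < n) F i = \sum_(i < n | (i < n)%N) F i.
  by apply: eq_bigl => i; rewrite ltn_ord.
(* the same [xi] serves for every tolerance; only [th] varies below *)
pose xi w := n%:R^-1 *: nearest K (S w).
have xiP : L2_valued P (Theta E X) xi.
  split=> [j|w].
    apply/(Lp_epsP P0) => //.
    apply: (@L2v_lipschitz _ _ P _ n%:R^-1
      (fun u => (n%:R^-1 *: nearest K u) ord0 j)) => //.
    move=> u v; rewrite !mxE -mulrBr normrM gtr0_norm // ler_pM2l //.
    have := coord_le_enorm (nearest K u - nearest K v) j.
    rewrite !mxE => /le_trans; apply; exact: nearest_nonexpansive.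
  have [[th hth thE] _] := nearK (S w).
  by exists th => //; rewrite /xi -thE sumE.
have errE w : enorm (n%:R^-1 *: \sum_(i < n) X i w - xi w) ^+ 2 =
    (n%:R^-1 * setdist K (S w)) ^+ 2.
  rewrite /xi -scalerBr enormZ gtr0_norm // -/(edist _ _); congr ((_ * _) ^+ 2).
  apply/eqP; rewrite eq_le setdist_le ?andbT; last by case: (nearK (S w)).
  by apply: le_setdist => //; case: (nearK (S w)).
have D1 : Lp_eps P 1 (fun w => setdist K (S w) ^+ 2) by exact: L1_setdist_sqr.
have errL1 : Lp_eps P 1 (fun w => (n%:R^-1 * setdist K (S w)) ^+ 2).
  apply: Lp_eps_sqr; apply: (@L2v_lipschitz _ _ P _ n%:R^-1
    (fun u => n%:R^-1 * setdist K u)) => //.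
  move=> u v; rewrite -mulrBr normrM gtr0_norm // ler_pM2l //.
  by rewrite (le_trans (setdist_lipschitz K0 _ _)) // mul1r.
have bound th :
    E (fun w => enorm (n%:R^-1 *: \sum_(i < n) X i w - xi w) ^+ 2) <=
    n%:R^-1 ^+ 2 * \sum_(i < n) E (fun w => enorm (X i w - th i) ^+ 2).
  rewrite (_ : (fun _ => _) = (fun w => (n%:R^-1 * setdist K (S w)) ^+ 2)).
    apply: (extend_le hP P0) => // mu Pmu.
    under eq_Rintegral do rewrite exprMn.
    rewrite RintegralZl //; last exact: Lp_eps1_integrable Pmu D1.
    rewrite ler_wpM2l ?sqr_ge0 //.
    apply: le_trans (Rintegral_le_extend hP P0 Pmu D1) _.
    rewrite sumE /S; under eq_fun do rewrite sumE.
    exact: extend_setdist_partial_sum_le.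
  by apply/funext => w; exact: errE.
have err_ge0 i th : 0 <= E (fun w => enorm (X i w - th) ^+ 2).
  have [mu Pmu] := P0; have h := L1_enorm_sqr th (X2 i).
  apply: le_trans (Rintegral_le_extend hP P0 Pmu h).
  by apply: Rintegral_ge0 => w _; exact: sqr_ge0.
have inf_le i : (ereal_inf [set (E (fun w => enorm (X i w - th) ^+ 2))%:E
    | th in Theta_i E X i] <= sigma2 E X)%E.
  by apply: ereal_sup_ubound; exists i.
have sigma_ge0 : (0 <= sigma2 E X)%E.
  apply: le_trans (inf_le (Ordinal n0)).
  by apply: le_ereal_inf_tmp => _ [th _ <-]; rewrite lee_fin.
move: sigma_ge0 inf_le; case: (sigma2 E X) => [s s0 inf_le|_ _|//]; last first.
  by rewrite gt0_mulye ?lte_fin // leey.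
rewrite -EFinM; apply/lee_addgt0Pr => e e0.
have /choice[th hth] : forall i, exists th, Theta_i E X i th /\
    E (fun w => enorm (X i w - th) ^+ 2) <= s + e.
  move=> i; have : (ereal_inf [set (E (fun w => enorm (X i w - th) ^+ 2))%:E
      | th in Theta_i E X i] < (s + e)%:E)%E.
    by apply: le_lt_trans (inf_le i) _; rewrite lte_fin ltrDl.
  move=> /ereal_inf_lt[_ [th hth <-]]; rewrite lte_fin => /ltW h.
  by exists th.
apply: (@le_trans _ _
    (E (fun w => enorm (n%:R^-1 *: \sum_(i < n) X i w - xi w) ^+ 2))%:E).
  by apply: ereal_inf_lbound; exists xi.
rewrite -EFinD lee_fin (le_trans (bound th)) //.
have nn : n%:R^-1 ^+ 2 * (n%:R * (s + e)) = (s + e) / n%:R.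
  by field; rewrite gt_eqF // ltr0n.
apply: (@le_trans _ _ (n%:R^-1 ^+ 2 * (n%:R * (s + e)))).
  rewrite ler_wpM2l ?sqr_ge0 // mulr_natl -[X in _ *+ X]card_ord -sumr_const.
  by apply: ler_sum => i _; case: (hth i).
have ninv1 : n%:R^-1 <= 1 :> R by rewrite invf_le1 ?ltr0n // ler1n.
by rewrite nn mulrDl lerD2l ler_piMr // ltW.
Qed.
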